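(* Let $T:\mathbf M\to\mathbf M$ be a Gibbs-Markov system with respect to the partition $\mathcal A$, with invariant probability measure $\mu$. Let $\{U_n\}$ be a good neighborhood system, with $\Lambda=\bigcap_nU_n$, such that the numbers $\{\hat\alpha_\ell\}_{\ell\ge1}$ exist and satisfy $\sum_\ell\ell\,\hat\alpha_\ell<\infty$. Then $$\alpha_1=\lim_{K\to\infty}\lim_{n\to\infty}\mu_{U_n}(\tau_{U_n}>K)$$ exists. Furthermore, the localized escape rate at $\Lambda$ exists and satisfies $$\rho(\Lambda,\{U_n\})=\alpha_1 .$$
   Context: Setting: $\mathbf M$ is a compact metric space, $\mathcal B$ its Borel $\sigma$-algebra, $T:\mathbf M\to\mathbf M$ a measurable map (not assumed invertible), $\mu$ a $T$-invariant probability measure, also written $\mathbb P$. $\mathcal A$ is a finite or countable measurable partition of $\mathbf M$, $\mathcal A^n=\bigvee_{j=0}^{n-1}T^{-j}\mathcal A$; elements of $\mathcal A^n$ are called $n$-cylinders, $A_n(x)$ is the $n$-cylinder containing $x$, and $\mathcal A$ is generating: $\bigcap_n A_n(x)=\{x\}$. Gibbs-Markov: $\mu(A)>0$ for all $A\in\mathcal A$; for every $A\in\mathcal A$, $T|_A$ is injective and $T(A)$ is a union of elements of $\mathcal A$; $T$ preserves $\mu$; (i) big image property: there is $C>0$ with $\mu(T(A))>C$ for all $A\in\mathcal A$; (ii) distortion: for a fixed $\lambda\in(0,1)$ and the metric $d_\lambda(x,y)=\lambda^{s(x,y)}$, where $s(x,y)$ is the largest positive integer $n$ such that $x,y$ lie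 in the same $n$-cylinder, the function $\log g|_A$, $g=\frac{d\mu}{d\mu\circ T}$, is $d_\lambda$-Lipschitz for all $A\in\mathcal A$, with a constant uniform in $A$. (With $g_n=g\cdot g\circ T\cdots g\circ T^{n-1}$, one then has a constant $D>1$ with $|g_n(x)/g_n(y)-1|\le D\,d_\lambda(T^nx,T^ny)$ for $x,y$ in the same $n$-cylinder, and $D^{-1}\le\mu(A_n(x))/g_n(x)\le D$.) Entry times: $\tau_U(x)=\min\{j\ge1:T^j(x)\in U\}$ ($=\infty$ if there is no such $j$); $\tau_U^1=\tau_U$, $\tau_U^j(x)=\tau_U^{j-1}(x)+\tau_U(T^{\tau_U^{j-1}(x)}(x))$, and $\tau_U^0=0$ on $U$. $\mu_U(\cdot)=\mu(\cdot\cap U)/\mu(U)$. Nested sequence: sets $U_n$ of positive measure with $U_{n+1}\subset U_n$ and $\mu(U_n)\to0$. Escape rate: $\rho(U)=\lim_{t\to\infty}\frac1t|\log\mathbb P(\tau_U>t)|$. Localized escape rate at $\Lambda=\bigcap_nU_n$: $\rho(\Lambda,\{U_n\})=\lim_{n\to\infty}\rho(U_n)/\mu(U_n)$. Good neighborhood system: a nested sequence $\{U_n\}$ such that each $U_n$ is a union of $\kappa_n$-cylinders for a non-decreasing sequence of integers $\kappa_n$, and (1) $\kappa_n\nearrow\infty$ and $\kappa_n\mu(U_n)^\varepsilon\to0$ for some $\varepsilon\in(0,1)$; (2) there exist $C>0$ and $p'>1$ with $\mu(U_n^j)\le\mu(U_n)+Cj^{-p'}$ for all $j<\kappa_n$,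 where $U_n^j=\bigcup\{A\in\mathcal A^j:A\cap U_n\neq\emptyset\}$. The numbers $\hat\alpha_\ell$: $\hat\alpha_\ell(K,U_n)=\mu_{U_n}(\tau_{U_n}^{\ell-1}\le K)$, $\hat\alpha_\ell(K)=\lim_{n\to\infty}\hat\alpha_\ell(K,U_n)$, $\hat\alpha_\ell=\lim_{K\to\infty}\hat\alpha_\ell(K)$. ''$\{\hat\alpha_\ell\}$ exists'' means that the limit $\hat\alpha_\ell(K)$ exists for all $K\in\mathbb N$ large enough and every $\ell\ge1$ (then $\hat\alpha_\ell$ exists by monotonicity in $K$, and $\hat\alpha_1=1$).
   Formalization: The measure μ is additionally assumed ergodic for T; without this the claim fails, e.g. for two disjoint full 2-shifts of mass 1/2 each with U_n shrinking cylinders in one of them, where α_1=1 but every escape rate is 0. *)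

(* Defs.v *)
From HB Require Import structures.
From mathcomp Require Import all_boot all_order all_algebra.
From mathcomp Require Import all_classical all_reals all_analysis.

Set Implicit Arguments.
Unset Strict Implicit.
Unset Printing Implicit Defensive.

Import Order.TTheory GRing.Theory Num.Theory.
Import numFieldNormedType.Exports.

Local Open Scope classical_set_scope.
Local Open Scope ring_scope.

(* The point is only there because [g_sigma_algebraType] asks for one. *)
#[short(type="pmetricType")]
HB.structure Definition PointedMetric (K : numDomainType) :=
  {M of Metric K M & Pointed M}.

Definition borel {R : realType} (M : pmetricType R) :=
  g_sigma_algebraType (@open M).

Definition union_of {X : Type} (C : set (set X)) (S : set X) :=
  exists2 D : set (set X), D `<=` C & S = \bigcup_(B in D) B.

Definition countable_partition d (X : measurableType d) (A : set (set X)) :=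
  [/\ countable A, A `<=` measurable, A `<=` [set B | B !=set0],
      trivIset A id & \bigcup_(B in A) B = [set: X]].

Section Cylinders.
Context {X : Type} (T : X -> X) (A : set (set X)).

(* The join of T^-j A over j < n. Only the entries j < n of [a] matter, and
   [cylinders 0] is the trivial partition. *)
Definition cylinders (n : nat) : set (set X) :=
  [set B | B !=set0 /\ exists2 a : nat -> set X,
     (forall j, (j < n)%N -> A (a j)) &
     B = \bigcap_(j in `I_n) (iter j T @^-1` a j)].

(* When A is a partition there is exactly one B in this union. *)
Definition cylinder_at (n : nat) (x : X) : set X :=
  \bigcup_(B in [set B | cylinders n B /\ B x]) B.

Definition same_cylinder (n : nat) (x y : X) :=
  exists B, [/\ cylinders n B, B x & B y].

Definition generating := forall x, \bigcap_n cylinder_at n x = [set x].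

Definition approx (U : set X) (j : nat) : set X :=
  \bigcup_(B in [set B | cylinders j B /\ B `&` U !=set0]) B.

(* +oo if x and y are never separated (that is, x = y when A is generating),
   and 0 if they already lie in different elements of A. *)
Definition separation {R : realType} (x y : X) : \bar R :=
  ereal_sup [set n%:R%:E | n in [set n | same_cylinder n x y]].

Definition dlambda {R : realType} (lambda : R) (x y : X) : R :=
  if separation x y is r%:E then lambda `^ r else 0.

End Cylinders.

Section GibbsMarkov.
Context d {X : measurableType d} {R : realType}.
Variables (mu : probability X R) (T : X -> X) (A : set (set X)).

Definition measure_preserving :=
  measurable_fun setT T /\
  (forall B, measurable B -> mu (T @^-1` B) = mu B).

(* Not a consequence of [gibbs_markov] below: two disjoint full shifts, with half
   of the mass on each, form a Gibbs-Markov system. There the escape rate of any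
   U contained in one component is 0. *)
Definition ergodic :=
  forall B, measurable B -> T @^-1` B = B -> mu B = 0%E \/ mu B = 1%E.

(* nu is the measure written mu o T: as T is only injective on each element of
   A, it is B |-> \sum_(a in A) mu (T (B `&` a)). Images of Borel sets under T
   injective on a Borel set are Borel, so mu is only evaluated on measurable
   sets here. *)
Definition is_image_measure (nu : {measure set X -> \bar R}) :=
  forall a B, A a -> measurable B -> B `<=` a -> nu B = mu (T @` B).

(* g is a version of d mu / d nu. *)
Definition is_density (nu : {measure set X -> \bar R}) (g : X -> R) :=
  [/\ measurable_fun setT g, (forall x, 0 < g x) &
      forall B, measurable B -> mu B = (\int[nu]_(x in B) (g x)%:E)%E].

Definition bounded_distortion (lambda : R) :=
  exists nu : {measure set X -> \bar R}, exists g : X -> R,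
  [/\ is_image_measure nu, is_density nu g &
      exists L : R, forall a x y, A a -> a x -> a y ->
        `|ln (g x) - ln (g y)| <= L * dlambda T A lambda x y].

Definition gibbs_markov (lambda : R) :=
  [/\ countable_partition A /\ generating T A,
      (forall a, A a -> (0 < mu a)%E),
      (forall a, A a -> set_inj a T /\ union_of A (T @` a)),
      measure_preserving &
      [/\ exists2 C : R, 0 < C & forall a, A a -> (C%:E < mu (T @` a))%E,
          0 < lambda < 1 & bounded_distortion lambda]].

End GibbsMarkov.

Section EntryTimes.
Context {X : Type} (T : X -> X).

(* [None] stands for the value +oo. *)
Definition entry_time (U : set X) (x : X) : option nat :=
  match pselect (exists j, (0 < j)%N && `[< U (iter j T x) >]) with
  | left h => Some (ex_minn h)
  | right _ => None
  end.

Fixpoint entry_time_iter (U : set X) (k : nat) (x : X) : option nat :=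
  if k is k'.+1 then
    if entry_time_iter U k' x is Some t
    then omap (addn t) (entry_time U (iter t T x)) else None
  else Some 0%N.

End EntryTimes.

Definition ext_time {R : realType} (t : option nat) : \bar R :=
  if t is Some m then m%:R%:E else +oo%E.

Section EscapeRates.
Context d {X : measurableType d} {R : realType}.
Variables (mu : probability X R) (T : X -> X).

Definition cond_prob (U E : set X) : R := fine (mu (E `&` U)) / fine (mu U).

Definition tau_gt (U : set X) (t : R) : set X :=
  [set x | (t%:E < ext_time (entry_time T U x))%E].

Definition tau_iter_le (U : set X) (k K : nat) : set X :=
  [set x | (ext_time (entry_time_iter T U k x) <= (K%:R : R)%:E)%E].

(* Extended-real valued: it is +oo as soon as mu (tau_gt U t) = 0. *)
Definition log_survival_rate (U : set X) (t : R) : \bar R :=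
  (t^-1%:E * `|lne (mu (tau_gt U t))|)%E.

Definition escape_rate (U : set X) : \bar R :=
  lim (log_survival_rate U t @[t --> +oo%R]).

Definition has_localized_escape_rate (U : nat -> set X) (l : \bar R) :=
  (forall n, cvg (log_survival_rate (U n) t @[t --> +oo%R])) /\
  (escape_rate (U n) / mu (U n))%E @[n --> \oo] --> l.

Definition nested_sequence (U : nat -> set X) :=
  [/\ (forall n, measurable (U n)), (forall n, (0 < mu (U n))%E),
      (forall n, U n.+1 `<=` U n) &
      mu (U n) @[n --> \oo] --> 0%E].

Definition good_neighborhood_system (A : set (set X)) (U : nat -> set X) :=
  nested_sequence U /\
  exists kappa : nat -> nat,
  [/\ {homo kappa : m n / (m <= n)%N},
      (forall n, union_of (cylinders T A (kappa n)) (U n)),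
      kappa n @[n --> \oo] --> \oo,
      (exists2 eps : R, 0 < eps < 1 &
        ((kappa n)%:R * fine (mu (U n)) `^ eps) @[n --> \oo] --> (0 : R)) &
      exists C p : R, [/\ 0 < C, 1 < p &
        forall n j, (0 < j < kappa n)%N ->
          (mu (approx T A (U n) j) <= mu (U n) + (C * j%:R `^ (- p))%:E)%E]].

(* The index l is the one of the mathematical notation, so l >= 1. *)
Definition hat_alpha_in (l K : nat) (U : set X) : R :=
  cond_prob U (tau_iter_le U l.-1 K).

Definition hat_alpha_K (U : nat -> set X) (l K : nat) : R :=
  limn (fun n => hat_alpha_in l K (U n)).

Definition hat_alpha (U : nat -> set X) (l : nat) : R :=
  limn (fun K => hat_alpha_K U l K).

Definition hat_alpha_exists (U : nat -> set X) :=
  exists K0 : nat, forall K l, (K0 <= K)%N -> (1 <= l)%N ->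
    cvgn (fun n => hat_alpha_in l K (U n)).

End EscapeRates.

(* Main.v *)
Require Import Defs.
From mathcomp Require Import all_boot all_order all_algebra.
From mathcomp Require Import all_classical all_reals all_analysis.
From mathcomp Require Import measurable_realfun ring lra zify.

(** The proof is elementary: it never introduces the transfer operator, and it
    works with sets instead of densities.

    Mixing.  For a set G that is a union of t-cylinders, let m_G be the measure
    E |-> mu (G `&` T^-t E).  Bounded distortion says that on each q-cylinder
    m_G is proportional to mu up to a factor exp (K lambda^q), with K
    independent of G ([regular], [admissible_determined]); with big images this
    gives m_G <= c mu(G) mu ([determined_upper_bound]).  The class of all
    measures with this regularity is stable under T.  Ergodicity and big images
    provide a Doeblin minorization: the average over a fixed number of iterates
    of any m in the class is at least eta m(X) mu ([minorization]).
    Subtracting a small multiple of m(X) mu stays in the class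
    ([contraction]), so iterating makes averages of iterates of m converge to
    m(X) mu geometrically, with an error relative to mu(E) and uniform in m
    and E.  Averages cannot be avoided, since an ergodic system may be
    periodic; but an event that concerns a long time window changes little
    under a bounded shift of the window, and for such events the averages may
    be dropped.  This is [block_mixing].

    Escape rate of one set.  Let U be a union of kappa-cylinders and a(t) the
    probability that the orbit avoids U during t steps.  Mixing gives
    a(t + kappa + s) <= c a(t) a(s), so the escape rate exists by
    subadditivity ([fekete_cvg]).  Cutting time into blocks of length s,
    separated by gaps of length kappa + N for the upper bound on a, shows that
    the escape rate is (1 - a(s)) / s up to a factor 1 + eps, as soon as s is
    large compared with kappa and N, and s mu(U) is small
    ([escape_rate_block_ge], [escape_rate_block_le]).

    Short blocks.  By invariance, decomposing according to the last visit to U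
    yields 1 - a(s) = mu(U) * \sum_(i < s) mu_U (tau > i)
    ([hit_prob_average]), so (1 - a(s)) / (s mu(U)) is the average over i < s
    of the conditional survival probabilities.  These are non-increasing in i,
    and between i = k and i = s they drop by at most
    c (s mu(U) + const * k^(1 - p)), by the hypothesis on the neighbourhoods
    approx U_n j ([short_returns]).  Hence for s mu(U) -> 0 the average tends to
    the limit alpha1 of mu_(U_n) (tau > k), first in n, then in k
    ([average_survival_cvg]).  The choice s_n = floor (mu(U_n) ^ -eps) makes s_n
    large compared with kappa_n while s_n mu(U_n) -> 0 ([block_length]). *)

Set Implicit Arguments.
Unset Strict Implicit.
Unset Printing Implicit Defensive.

Import Order.TTheory GRing.Theory Num.Theory.
Import numFieldNormedType.Exports.

Local Open Scope classical_set_scope.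
Local Open Scope ring_scope.

(** * Countably additive real-valued set functions *)

Section SetFunctions.
Context d {X : measurableType d} {R : realType}.
Implicit Types (m : set X -> R) (E G : set X) (F : nat -> set X).

Definition measurable_partition F :=
  [/\ forall i, measurable (F i), trivIset setT F & \bigcup_i F i = setT].

(** Real-valued set functions take the place of measures, because differences
    m - eta mu have to be formed.  The two conditions are the only
    forms of additivity in use: splitting by one set, and summing along a
    countable partition. *)
Definition countably_additive m :=
  (forall E G, measurable E -> measurable G ->
     m E = m (E `&` G) + m (E `\` G)) /\
  (forall E F, measurable E -> measurable_partition F ->
     (fun n => \sum_(i < n) m (E `&` F i)) @ \oo --> m E).

Definition nonneg_on_measurable m := forall E, measurable E -> 0 <= m E.

Lemma countably_additive0 m : countably_additive m -> m set0 = 0.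
Proof.
case=> add _; have := add set0 set0 measurable0 measurable0.
by rewrite setI0 setD0 => /esym/eqP; rewrite -subr_eq0 addrK => /eqP.
Qed.

Lemma countably_additive_le m E G : countably_additive m ->
  nonneg_on_measurable m -> measurable E -> measurable G -> E `<=` G ->
  m E <= m G.
Proof.
move=> [add _] m0 mE mG EG; rewrite (add G E)// (setIidr EG) lerDl m0//.
exact: measurableD.
Qed.

(** Every argument by summation over the countable partition goes through this
    comparison, which avoids manipulating infinite sums. *)
Lemma le_countably_additive m m' E G F : countably_additive m ->
  countably_additive m' -> measurable E -> measurable G ->
  measurable_partition F ->
  (forall i, m (E `&` F i) <= m' (G `&` F i)) -> m E <= m' G.
Proof.
move=> [_ cm] [_ cm'] mE mG pF le_mm'.
apply: (ler_cvg_to (cm E F mE pF) (cm' G F mG pF)).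
by near=> n; apply: ler_sum => i _; exact: le_mm'.
Unshelve. all: by end_near. Qed.

Lemma countably_additive_comb m m' (a b : R) : countably_additive m ->
  countably_additive m' -> countably_additive (fun E => a * m E + b * m' E).
Proof.
move=> [add cm] [add' cm']; split=> [E G mE mG|E F mE pF].
  by rewrite (add E G)// (add' E G)//; ring.
have -> : (fun n => \sum_(i < n) (a * m (E `&` F i) + b * m' (E `&` F i))) =
    (fun n => a * (\sum_(i < n) m (E `&` F i)) +
              b * (\sum_(i < n) m' (E `&` F i))).
  by apply/funext => n; rewrite big_split/= !mulr_sumr.
by apply: cvgD; apply: cvgMl_tmp; [exact: cm|exact: cm'].
Qed.

Lemma countably_additive_scale m (a : R) : countably_additive m ->
  countably_additive (fun E => a * m E).
Proof.
move=> cm; have := countably_additive_comb a 0 cm cm.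
by congr countably_additive; apply/funext => E; rewrite mul0r addr0.
Qed.

Lemma countably_additive_restrict m G : countably_additive m -> measurable G ->
  countably_additive (fun E => m (G `&` E)).
Proof.
move=> [add cm] mG; split=> [E E' mE mE'|E F mE pF].
  rewrite (add (G `&` E) E')//; last exact: measurableI.
  by rewrite setIDA setIA.
have -> : (fun n => \sum_(i < n) m (G `&` (E `&` F i))) =
          (fun n => \sum_(i < n) m ((G `&` E) `&` F i)).
  by apply/funext => n; apply: eq_bigr => i _; rewrite setIA.
by apply: cm => //; exact: measurableI.
Qed.

Lemma measurable_preimage (T : X -> X) E : measurable_fun setT T ->
  measurable E -> measurable (T @^-1` E).
Proof. by move=> mT mE; rewrite -[T @^-1` E]setTI; exact: mT. Qed.

Lemma measurable_partition_preimage (T : X -> X) F : measurable_fun setT T ->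
  measurable_partition F -> measurable_partition (fun i => T @^-1` F i).
Proof.
move=> mT [mF tF cF]; split=> [i||]; first exact: measurable_preimage.
- move=> i j _ _ [x [/= Fix Fjx]]; apply: tF => //.
  by exists (T x).
- by rewrite -preimage_bigcup cF.
Qed.

Lemma countably_additive_preimage m (T : X -> X) : measurable_fun setT T ->
  countably_additive m -> countably_additive (fun E => m (T @^-1` E)).
Proof.
move=> mT [add cm]; split=> [E G mE mG|E F mE pF].
  by rewrite (add _ (T @^-1` G))//; exact: measurable_preimage.
apply: (cm _ (fun i => T @^-1` F i)); first exact: measurable_preimage.
exact: measurable_partition_preimage.
Qed.

Definition fprob (mu : probability X R) E : R := fine (mu E).

Variable mu : probability X R.
Local Notation P := (fprob mu).

Lemma fine_probability_ge0 : nonneg_on_measurable P.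
Proof. by move=> E mE; rewrite /fprob fine_ge0. Qed.

Lemma probability_fineK E : measurable E -> (P E)%:E = mu E.
Proof. by move=> mE; rewrite /fprob fineK// fin_num_measure. Qed.

Lemma countably_additive_probability : countably_additive P.
Proof.
split=> [E G mE mG|E F mE [mF tF cF]].
  apply: EFin_inj; rewrite EFinD !probability_fineK//; last 2 first.
  - exact: measurableD.
  - exact: measurableI.
  by rewrite -measureU ?setUIDK//;
    [exact: measurableI|exact: measurableD|rewrite setDE setIACA setICr !setI0].
have mEF i : measurable (E `&` F i) by exact: measurableI.
have EU : \bigcup_i (E `&` F i) = E by rewrite -setI_bigcupr cF setIT.
have : (\sum_(0 <= i < n) mu (E `&` F i))%E @[n --> \oo] --> mu E.
  rewrite -[in X in _ --> X]EU; apply: measure_semi_sigma_additive => //.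
  - exact: trivIset_setIl.
  - by rewrite EU.
rewrite -probability_fineK// => /fine_cvg; apply: cvg_trans.
apply: near_eq_cvg; near=> n.
rewrite /= big_mkord -[RHS]/(fine (_ %:E)) -sumEFin; congr fine.
by apply: eq_bigr => i _; rewrite probability_fineK.
Unshelve. all: by end_near. Qed.

End SetFunctions.

(** * Cylinders and bounded distortion *)

Section Itineraries.
Context {X : Type} (T : X -> X) (A : set (set X)).
Implicit Types (a : nat -> set X) (t : nat) (x y : X).

Definition cylinder a t : set X := \bigcap_(j in `I_t) (iter j T @^-1` a j).

Definition itinerary a t := forall j, (j < t)%N -> A (a j).

Lemma cylinder0 a : cylinder a 0 = setT.
Proof. by apply/seteqP; split. Qed.

Lemma cylinderS a t : cylinder a t.+1 = cylinder a t `&` iter t T @^-1` a t.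
Proof.
apply/seteqP; split=> [x cx|x [cx ax] j /=].
  by split=> [j jt|]; [by apply: cx; exact: ltnW|by apply: cx => /=].
by rewrite ltnS leq_eqVlt => /predU1P[->|/cx].
Qed.

Lemma iter_preimageS t (E : set X) :
  iter t.+1 T @^-1` E = T @^-1` (iter t T @^-1` E).
Proof. by apply/funext => x; rewrite /preimage/= -iterSr. Qed.

Lemma same_cylinderP t x y : same_cylinder T A t x y <->
  forall j, (j < t)%N -> exists2 b, A b & b (iter j T x) /\ b (iter j T y).
Proof.
split=> [[B [[_ [a Aa ->]] Bx By]] j jt|xy].
  by exists (a j); [exact: Aa|split; [exact: Bx|exact: By]].
have /choice[a aP] j : exists b, (j < t)%N ->
    [/\ A b, b (iter j T x) & b (iter j T y)].
  have [/xy[b Ab [bx by_]]|_] := ltnP j t; last by exists set0.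
  by exists b.
have cx : cylinder a t x by move=> j /aP[].
exists (cylinder a t); split=> //; last by move=> j /aP[].
by split; [exists x|exists a => // j /aP[]].
Qed.

Lemma same_cylinder_le s t x y : (s <= t)%N ->
  same_cylinder T A t x y -> same_cylinder T A s x y.
Proof.
move=> st /same_cylinderP xy; apply/same_cylinderP => j js.
by apply: xy; exact: leq_trans st.
Qed.

Lemma same_cylinder_iter i t x y : same_cylinder T A (i + t) x y ->
  same_cylinder T A t (iter i T x) (iter i T y).
Proof.
move=> /same_cylinderP xy; apply/same_cylinderP => j jt.
by rewrite -!iterD addnC; apply: xy; rewrite ltn_add2l.
Qed.

Lemma same_cylinder_sym t x y :
  same_cylinder T A t x y -> same_cylinder T A t y x.
Proof. by case=> B [? ? ?]; exists B. Qed.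

(** The sets that are unions of t-cylinders, described as saturated sets: this
    form is stable under the set operations below without any countability
    argument. *)
Definition determined t (G : set X) :=
  forall x y, same_cylinder T A t x y -> G x -> G y.

Lemma determined_le s t G : (s <= t)%N -> determined s G -> determined t G.
Proof. by move=> st dG x y /(same_cylinder_le st); exact: dG. Qed.

Lemma determined_cylinder t G a : determined t G -> itinerary a t ->
  cylinder a t `<=` G \/ cylinder a t `&` G = set0.
Proof.
move=> dG Aa; have [|/set0P[x [ax Gx]]] := eqVneq (cylinder a t `&` G) set0.
  by right.
left=> y ay; apply: dG Gx; apply/same_cylinderP => j jt.
by exists (a j); [exact: Aa|split; [exact: ax|exact: ay]].
Qed.

Hypothesis tA : trivIset A id.

Lemma itinerary_unique t a x y : itinerary a t -> cylinder a t x ->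
  same_cylinder T A t x y -> cylinder a t y.
Proof.
move=> Aa ax /same_cylinderP xy j /= jt; have [b Ab [bx by_]] := xy j jt.
rewrite /preimage/= (_ : a j = b)//; apply: tA => //; first exact: Aa.
by exists (iter j T x); split; [exact: ax|].
Qed.

Lemma determined_union_of t G : union_of (cylinders T A t) G -> determined t G.
Proof.
move=> [D sD ->] x y xy [B DB Bx]; exists B => //.
have [_ [a Aa aB]] := sD _ DB; rewrite aB in Bx *.
exact: itinerary_unique Bx xy.
Qed.

End Itineraries.

Section MarkovPartition.
Context d {X : measurableType d} {R : realType}.
Variables (mu : probability X R) (T : X -> X) (A : set (set X)) (lambda : R).
Hypothesis GM : gibbs_markov mu T A lambda.
Local Notation P := (fprob mu).
Implicit Types (E F G : set X) (m : set X -> R).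

Lemma gm_partition : countable_partition A. Proof. by case: GM => -[]. Qed.
Lemma gm_trivIset : trivIset A id. Proof. by case: gm_partition. Qed.
Lemma gm_measurable : A `<=` measurable. Proof. by case: gm_partition. Qed.
Lemma gm_cover x : exists2 a, A a & a x.
Proof.
by case: gm_partition => _ _ _ _ /seteqP[_ /(_ x I)] [a Aa ax]; exists a.
Qed.
Lemma gm_measurableT : measurable_fun setT T.
Proof. by case: GM => _ _ _ [] . Qed.
Lemma gm_lambda : 0 < lambda < 1. Proof. by case: GM => _ _ _ _ []. Qed.

Lemma gm_eq a b x : A a -> A b -> a x -> b x -> a = b.
Proof. by move=> Aa Ab ax bx; apply: gm_trivIset => //; exists x. Qed.

Lemma gm_pos a : A a -> 0 < P a.
Proof.
move=> Aa; case: GM => _ /(_ _ Aa) + _ _ _.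
by rewrite -probability_fineK ?lte_fin//; exact: gm_measurable.
Qed.

Lemma probability_preimage E : measurable E -> P (T @^-1` E) = P E.
Proof. by move=> mE; rewrite /P; case: GM => _ _ _ [_ ->]. Qed.

Lemma measurable_fun_iter t : measurable_fun setT (iter t T).
Proof.
elim: t => [|t IH]; first exact: measurable_id.
exact: (measurableT_comp gm_measurableT IH).
Qed.

Lemma measurable_iter_preimage t E : measurable E ->
  measurable (iter t T @^-1` E).
Proof. exact/measurable_preimage/measurable_fun_iter. Qed.

Lemma probability_iter_preimage t E : measurable E ->
  P (iter t T @^-1` E) = P E.
Proof.
move=> mE; elim: t => [//|t IH]; rewrite iter_preimageS.
by rewrite probability_preimage//; exact: measurable_iter_preimage.
Qed.

Lemma measurable_cylinder a t : itinerary A a t -> measurable (cylinder T a t).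
Proof.
elim: t => [|t IH] Aa; first by rewrite cylinder0.
rewrite cylinderS; apply: measurableI; first by apply: IH => j jt; exact/Aa/ltnW.
by apply: measurable_iter_preimage; apply/gm_measurable/Aa.
Qed.

Lemma countable_cylinders t : countable (cylinders T A t).
Proof.
have [cA _ _ _ _] := gm_partition.
elim: t => [|t IH].
  apply: (sub_countable _ (countable1 [set: X])); apply: subset_card_le.
  by move=> B [_ [a _ ->]]; exact: cylinder0.
pose f (BC : set X * set X) := BC.1 `&` iter t T @^-1` BC.2.
apply: (sub_countable _ (countableX IH cA)).
apply: card_le_trans (card_image_le f _); apply: subset_card_le.
move=> B [[x Bx] [a Aa aB]].
have aB' : B = cylinder T a t.+1 by [].
exists (cylinder T a t, a t); last by rewrite /f/= aB' cylinderS.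
split=> /=; last exact: Aa.
split; last by exists a => // j jt; apply: Aa; exact: ltnW.
by exists x; move: Bx; rewrite aB' cylinderS => -[].
Qed.

(** The empty set pads the enumeration, which makes it total on nat even when
    the family is finite. *)
Lemma countable_enumeration (D : set (set X)) : countable D -> trivIset D id ->
  exists F : nat -> set X, [/\ forall i, F i = set0 \/ D (F i),
    forall a, D a -> exists i, F i = a & trivIset setT F].
Proof.
move=> /countable_injP[f finj] tD.
pose F i := \bigcup_(a in [set a | D a /\ f a = i]) a.
have FE a : D a -> F (f a) = a.
  move=> Da; apply/seteqP; split=> [x [b [Db /finj ba]]|x ax]; last by exists a.
  by rewrite -ba// inE.
exists F; split=> [i|a Da|i j _ _ [x [[a [Da <-] ax] [b [Db <-] bx]]]].
- have [[a [Da ai]]|nai] := pselect (exists a, D a /\ f a = i).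
    by right; rewrite -ai FE.
  by left; apply/seteqP; split=> // x [a ? _]; apply: nai; exists a.
- by exists (f a); exact: FE.
- by congr f; apply: tD => //; exists x.
Qed.

Lemma bigcup_countable_measurable (D : set (set X)) : countable D ->
  D `<=` measurable -> measurable (\bigcup_(B in D) B).
Proof.
move=> /countable_injP[f finj] mD.
have -> : \bigcup_(B in D) B = \bigcup_i \bigcup_(B in [set B | D B /\ f B = i]) B.
  apply/seteqP; split=> [x [B DB Bx]|x [i _ [B [DB _] Bx]]]; last by exists B.
  by exists (f B) => //; exists B.
apply: bigcupT_measurable => i.
have [[B [DB Bi]]|nB] := pselect (exists B, D B /\ f B = i).
  have -> : [set B | D B /\ f B = i] = [set B].
    apply/seteqP; split=> [C [DC Ci]|C ->//]; apply: finj; rewrite ?inE//.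
    by rewrite Ci.
  by rewrite bigcup_set1; exact: mD.
rewrite (_ : [set B | _] = set0) ?bigcup_set0//.
by apply/seteqP; split=> // B ?; apply: nB; exists B.
Qed.

Lemma measurable_union_of t G : union_of (cylinders T A t) G -> measurable G.
Proof.
move=> [D sD ->]; apply: bigcup_countable_measurable => [|B /sD[_ [a Aa ->]]].
  exact: sub_countable (subset_card_le sD) (countable_cylinders t).
exact: measurable_cylinder.
Qed.

Lemma measurable_union_of_partition G : union_of A G -> measurable G.
Proof.
have [cA _ _ _ _] := gm_partition.
move=> [D sD ->]; apply: bigcup_countable_measurable => [|B /sD].
  exact: sub_countable (subset_card_le sD) cA.
exact: gm_measurable.
Qed.

Lemma gm_enumeration : exists F : nat -> set X,
  [/\ measurable_partition F, forall i, F i = set0 \/ A (F i) &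
      forall a, A a -> exists i, F i = a].
Proof.
have [cA _ _ _ _] := gm_partition.
have [F [FA AF tF]] := countable_enumeration cA gm_trivIset.
exists F; split=> //; split=> // [i|].
  by have [->|/gm_measurable] := FA i.
apply/seteqP; split=> // x _; have [a /AF[i <-] ax] := gm_cover x.
by exists i.
Qed.

(** Refines G one time step after the other, so that only the partition A, and
    not the partition into t-cylinders, has to be enumerated. *)
Lemma le_on_cylinders m m' t G G' : countably_additive m ->
  countably_additive m' -> measurable G -> measurable G' ->
  (forall a, itinerary A a t ->
    m (G `&` cylinder T a t) <= m' (G' `&` cylinder T a t)) ->
  m G <= m' G'.
Proof.
move=> cm cm' mG mG'; have [F [pF FA _]] := gm_enumeration.
elim: t => [|t IH] mm'.
  have A0 : itinerary A (fun=> set0) 0 by [].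
  by have := mm' _ A0; rewrite cylinder0 !setIT.
apply: IH => a Aa; have mc := measurable_cylinder Aa.
apply: (le_countably_additive cm cm' _ _
  (measurable_partition_preimage (measurable_fun_iter t) pF)) => [||i].
- exact: measurableI.
- exact: measurableI.
have [->|AFi] := FA i.
  by rewrite preimage_set0 !setI0 (countably_additive0 cm) (countably_additive0 cm').
pose b j := if (j < t)%N then a j else F i.
have Ab : itinerary A b t.+1.
  by move=> j _; rewrite /b; case: ifPn => // jt; exact: Aa.
have cb : cylinder T b t.+1 = cylinder T a t `&` iter t T @^-1` F i.
  rewrite cylinderS {2}/b ltnn; congr (_ `&` _).
  by apply/seteqP; split=> x cx j /= jt; have := cx j jt; rewrite /b jt.
by have := mm' b Ab; rewrite cb !setIA.
Qed.

Lemma dlambda_le n x y : same_cylinder T A n x y ->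
  dlambda T A lambda x y <= lambda ^+ n.
Proof.
have /andP[l0 l1] := gm_lambda => xy.
have : (n%:R%:E <= separation T A x y :> \bar R)%E.
  by apply: ereal_sup_ubound; exists n.
have ln0 : 0 <= lambda ^+ n by rewrite exprn_ge0// ltW.
rewrite /dlambda; case: separation => [r| |]//; rewrite lee_fin => nr.
rewrite -powR_mulrn ?(ltW l0)// /powR gt_eqF//.
by rewrite ler_expR ler_wnM2r// ln_le0// ltW.
Qed.

Definition distortion_bound (L : R) :=
  forall a D n, A a -> measurable D -> D `<=` T @` a ->
    (forall x y, a x -> D (T x) -> a y -> D (T y) -> same_cylinder T A n x y) ->
  exists2 rho, 0 < rho & forall E, measurable E -> E `<=` D ->
    rho * P E <= P (a `&` T @^-1` E) <= expR (L * lambda ^+ n) * (rho * P E).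

(** On a branch a, the measure B |-> mu (T B) takes the value mu E at
    a `&` T^-1 E, so mu (a `&` T^-1 E) is an integral of g against a measure of
    total mass mu E.  As g varies by a factor exp (L1 lambda^n) around its value
    at a base point, the integral is pinned up to the square of this factor,
    whence L = 2 L1.  Images under T of general Borel sets never occur: T maps
    a `&` T^-1 E onto E. *)
Lemma branch_distortion : exists2 L : R, 0 <= L & distortion_bound L.
Proof.
have /andP[l0 l1] := gm_lambda.
case: (GM) => _ _ _ _ [_ _ [nu [g [nuT [mg g0 mug] [L0 lipg]]]]].
pose L1 := Num.max L0 0; exists (2 * L1).
  by rewrite mulr_ge0// le_max lexx orbT.
move=> a D n Aa mD DT aD.
have [->|/set0P[y0 Dy0]] := eqVneq D set0.
  exists 1 => // E mE; rewrite subset0 => ->.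
  have P0 : P set0 = 0 by rewrite /fprob measure0.
  by rewrite preimage_set0 setI0 P0 !mulr0 lexx.
have [x0 ax0 Tx0] := DT _ Dy0.
pose e := L1 * lambda ^+ n.
exists (g x0 * expR (- e)); first by rewrite mulr_gt0 ?expR_gt0.
move=> E mE ED; set S := a `&` _.
have mS : measurable S.
  apply: measurableI; first exact: gm_measurable.
  exact: measurable_preimage gm_measurableT mE.
have nuS : nu S = mu E.
  rewrite (nuT a S Aa mS); last by move=> x [].
  congr (mu _); apply/seteqP; split=> [_ [x [_ ?] <-]//|y Ey].
  have [x ax xy] := DT _ (ED _ Ey); exists x => //.
  by split => //; rewrite /preimage/= xy.
have gS x : S x -> g x0 * expR (- e) <= g x <= g x0 * expR e.
  move=> [ax Ex]; have xx0 : same_cylinder T A n x x0.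
    by apply: aD => //; [exact: ED|rewrite Tx0].
  have : `|ln (g x) - ln (g x0)| <= e.
    apply: (le_trans (lipg a x x0 Aa ax ax0)).
    rewrite (le_trans (y := L1 * dlambda T A lambda x x0))//.
      rewrite ler_wpM2r ?le_max ?lexx// /dlambda; case: separation => // r.
      exact: powR_ge0.
    by rewrite ler_wpM2l ?dlambda_le// le_max lexx orbT.
  rewrite ler_norml => /andP[lo hi].
  rewrite -{1 2}[g x0]lnK ?posrE// -[g x]lnK ?posrE// -!expRD !ler_expR.
  by apply/andP; split; lra.
have PS : (P S)%:E = (\int[nu]_(x in S) (g x)%:E)%E.
  by rewrite probability_fineK// mug.
have mgS : measurable_fun S g by exact: measurable_funTS.
have cS (r : R) : (\int[nu]_(x in S) r%:E)%E = (r * P E)%:E.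
  by rewrite integral_cst// nuS -probability_fineK// EFinM.
apply/andP; split.
  rewrite -lee_fin PS -cS; apply: ge0_le_integral => //.
  - by move=> x _; rewrite lee_fin mulr_ge0 ?expR_ge0// ltW.
  - exact/measurable_EFinP.
  - by move=> x /gS/andP[+ _]; rewrite lee_fin.
rewrite (_ : _ * _ = (g x0 * expR e) * P E); last first.
  rewrite -/e !mulrA; congr (_ * _).
  rewrite [expR _ * g x0]mulrC -mulrA -expRD; congr (_ * expR _).
  by rewrite /e; ring.
rewrite -lee_fin PS -cS; apply: ge0_le_integral => //.
- by move=> x _; rewrite lee_fin ltW.
- exact/measurable_EFinP.
- by move=> x /gS/andP[_ +]; rewrite lee_fin.
Qed.

End MarkovPartition.

(** * Measures with regular densities *)

Section RegularClass.
Context d {X : measurableType d} {R : realType}.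
Variables (mu : probability X R) (T : X -> X) (A : set (set X)) (lambda : R).
Hypothesis GM : gibbs_markov mu T A lambda.
Local Notation P := (fprob mu).
Implicit Types (E F G : set X) (m : set X -> R).

Let mT := gm_measurableT GM.
Let l01 := gm_lambda GM.
Let l0 : 0 < lambda. Proof. by case/andP: l01. Qed.
Let mA := gm_measurable GM.
Let P0 := @fine_probability_ge0 _ _ _ mu.
Let Pca := @countably_additive_probability _ _ _ mu.

(** If m has a density f with respect to mu, this says that the oscillation of
    ln f on q-cylinders is at most K lambda^q.  The cross-multiplied form needs
    no density and no care about null sets.  The case q = 0 is excluded, since
    m may vanish on part of the space. *)
Definition regular K m := forall q Q E F, (0 < q)%N -> cylinders T A q Q ->
  measurable E -> measurable F -> E `<=` Q -> F `<=` Q ->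
  m E * P F <= expR (K * lambda ^+ q) * (m F * P E).

Definition admissible K m :=
  [/\ countably_additive m, nonneg_on_measurable m & regular K m].

Lemma regular_le K K' m : nonneg_on_measurable m -> K <= K' ->
  regular K m -> regular K' m.
Proof.
move=> m0 KK' rm q Q E F q0 cQ mE mF EQ FQ.
apply: (le_trans (rm q Q E F q0 cQ mE mF EQ FQ)).
apply: ler_wpM2r; first by rewrite mulr_ge0 ?m0 ?P0.
by rewrite ler_expR ler_wpM2r// exprn_ge0// ltW.
Qed.

Lemma admissible_le K K' m : K <= K' -> admissible K m -> admissible K' m.
Proof. by move=> KK' [? ? ?]; split=> //; exact: regular_le KK' _. Qed.

Lemma cylinders_cons a q Q : A a -> cylinders T A q Q ->
  a `&` T @^-1` Q !=set0 -> cylinders T A q.+1 (a `&` T @^-1` Q).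
Proof.
move=> Aa [_ [b Ab QE]] aQ0; split=> //.
exists (fun j => if j is j'.+1 then b j' else a) => [[|j]//|]; first exact: Ab.
rewrite QE; apply/seteqP; split=> [x [ax bx] [|j]//= jq|x bx].
  by rewrite /preimage/= -iterS iterSr; exact: bx.
split; first exact: (bx 0%N).
by move=> j jq; have := bx j.+1 jq; rewrite /preimage/= -iterS iterSr.
Qed.

Lemma cylinders1 a : A a -> cylinders T A 1 a.
Proof.
move=> Aa; split; first by case: (gm_partition GM) => _ _ + _ _; exact.
exists (fun=> a) => //; apply/seteqP; split=> [x ax [|//]//|x ax].
exact: (ax 0%N).
Qed.

Lemma image_union a : A a -> union_of A (T @` a).
Proof. by case: GM => _ _ + _ _ => /[apply] -[]. Qed.

Lemma measurable_image a : A a -> measurable (T @` a).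
Proof. by move=> /image_union; exact: measurable_union_of_partition GM _. Qed.

(** The Markov property: T a is a union of elements of the partition. *)
Lemma partition_sub_image a b : A a -> A b -> b `&` T @` a !=set0 ->
  b `<=` T @` a.
Proof.
move=> Aa Ab [x [bx]]; have [D DA ->] := image_union Aa.
move=> [b' Db' b'x]; have <- : b' = b by apply: (gm_eq GM _ _ b'x) => //; exact: DA.
by move=> y b'y; exists b'.
Qed.

Lemma cylinders_sub_image a q Q : A a -> (0 < q)%N -> cylinders T A q Q ->
  Q `&` T @` a !=set0 -> Q `<=` T @` a.
Proof.
move=> Aa q0 [_ [b Ab QE]] [x [Qx Tax]].
have bQ : Q `<=` b 0%N by rewrite QE => y /(_ 0%N q0).
apply: (subset_trans bQ); apply: partition_sub_image => //; first exact: Ab.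
by exists x; split=> //; exact: bQ.
Qed.

Variable L : R.
Hypothesis BD : distortion_bound mu T A lambda L.

(** Pulling back by one branch turns a q-cylinder into a (q+1)-cylinder, which
    contracts the constant K by lambda, while the branch itself adds L lambda.
    The constant rho of the branch cancels from the inequality. *)
Lemma regular_branch K m a q Q E F : admissible K m -> A a -> (0 < q)%N ->
  cylinders T A q Q -> measurable E -> measurable F -> E `<=` Q -> F `<=` Q ->
  m (a `&` T @^-1` E) * P F <=
  expR (lambda * (K + L) * lambda ^+ q) * (m (a `&` T @^-1` F) * P E).
Proof.
move=> [cm m0 rm] Aa q0 cQ mE mF EQ FQ.
have [Qa|/set0P[x Qax]] := eqVneq (Q `&` T @` a) set0.
  have aE H : H `<=` Q -> a `&` T @^-1` H = set0.
    move=> HQ; apply/seteqP; split=> // x [ax Hx].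
    by rewrite -[set0 x]/(set0 (T x)) -Qa; split; [exact: HQ|exists x].
  by rewrite !aE// (countably_additive0 cm) !mul0r mulr0.
have QT : Q `<=` T @` a by apply: (cylinders_sub_image Aa q0 cQ); exists x.
have cQ' : cylinders T A q.+1 (a `&` T @^-1` Q).
  apply: cylinders_cons => //; case: Qax => Qx [y ay yx]; exists y; split=> //.
  by rewrite /preimage/= yx.
have mQ : measurable Q.
  by case: cQ => _ [b Ab ->]; exact: measurable_cylinder GM _ _ Ab.
have [|rho rho0 rhoP] := BD (n := q.+1) Aa mQ QT.
  by move=> y z ay Qy az Qz; exists (a `&` T @^-1` Q).
have mp H : measurable H -> measurable (a `&` T @^-1` H).
  by move=> mH; apply: measurableI; [exact: mA|exact: measurable_preimage].
have mE' := mp _ mE; have mF' := mp _ mF.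
have := rm q.+1 _ _ _ isT cQ' mE' mF' (setIS (preimage_subset EQ))
  (setIS (preimage_subset FQ)).
have /andP[_ rE] := rhoP E mE EQ; have /andP[rF _] := rhoP F mF FQ.
(* rho m(E') mu(F) <= m(E') mu(F') <= e1 m(F') mu(E')
   <= e1 e2 rho m(F') mu(E), where the prime denotes preimages in a and
   e1, e2 are the distortion factors of m and of the branch. *)
move: rE rF; set E' := a `&` _; set F' := a `&` _ => rE rF rEF.
rewrite -(ler_pM2l rho0) mulrCA (le_trans (ler_wpM2l (m0 _ mE') rF))//.
rewrite (le_trans rEF)//.
rewrite (le_trans (y := expR (K * lambda ^+ q.+1) *
   (m F' * (expR (L * lambda ^+ q.+1) * (rho * P E)))))//.
  by rewrite ler_wpM2l ?expR_ge0// ler_wpM2l ?m0.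
rewrite le_eqVlt; apply/orP; left; apply/eqP.
rewrite -mulrA mulrDl mulrDr.
rewrite (_ : expR _ * (m F' * (expR _ * _)) = expR (K * lambda ^+ q.+1) *
  expR (L * lambda ^+ q.+1) * (rho * (m F' * P E))); last by ring.
rewrite -expRD mulrCA; congr (_ * (expR _ * _)) => //; rewrite exprS; ring.
Qed.

Lemma admissible_branch K m a : admissible K m -> A a ->
  admissible (lambda * (K + L)) (fun E => m (a `&` T @^-1` E)).
Proof.
move=> am Aa; case: (am) => cm m0 _; split=> [|E mE|].
- have := countably_additive_preimage mT
    (countably_additive_restrict cm (mA Aa)); exact.
- by apply/m0/measurableI; [exact: mA|exact: measurable_preimage].
- by move=> *; apply: regular_branch; eassumption.
Qed.

(** The class is stable under the push-forward by T, which is the sum of the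
    contributions of the branches. *)
Lemma admissible_preimage K m : admissible K m ->
  admissible (lambda * (K + L)) (fun E => m (T @^-1` E)).
Proof.
move=> am; case: (am) => cm m0 _; split=> [|E mE|].
- exact: countably_additive_preimage.
- by apply/m0/measurable_preimage.
move=> q Q E F q0 cQ mE mF EQ FQ.
have [S [pS SA _]] := gm_enumeration GM.
have mTE := measurable_preimage mT mE; have mTF := measurable_preimage mT mF.
rewrite [leLHS]mulrC mulrA mulrAC.
apply: (le_countably_additive (countably_additive_scale (P F) cm)
  (countably_additive_scale
    (expR (lambda * (K + L) * lambda ^+ q) * P E) cm) mTE mTF pS) => i.
have [->|ASi] := SA i; first by rewrite !setI0 (countably_additive0 cm) !mulr0.
rewrite ![_ `&` S i]setIC [leLHS]mulrC -mulrA [P E * _]mulrC.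
exact: (regular_branch am ASi q0 cQ).
Qed.

Lemma admissible_probability K : 0 <= K -> admissible K P.
Proof.
move=> K0; split=> // q Q E F _ _ mE mF _ _.
rewrite mulrC ler_peMl ?mulr_ge0 ?P0//.
by rewrite -expR0 ler_expR mulr_ge0// exprn_ge0// ltW.
Qed.

Variable K : R.
Hypothesis K0 : 0 <= K.
Hypothesis KL : lambda * (K + L) <= K.

Lemma admissible_preimageK m : admissible K m ->
  admissible K (fun E => m (T @^-1` E)).
Proof. by move=> /admissible_preimage; exact: admissible_le. Qed.

Lemma admissible_iter_preimage t m : admissible K m ->
  admissible K (fun E => m (iter t T @^-1` E)).
Proof.
by move=> am; elim: t => [//|t IH]; exact: (admissible_preimageK IH).
Qed.

Lemma admissible_cylinder a t : itinerary A a t ->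
  admissible K (fun E => P (cylinder T a t `&` iter t T @^-1` E)).
Proof.
elim: t => [|t IH] Aa.
  rewrite (_ : (fun E => _) = P); first exact: admissible_probability.
  by apply/funext => E; rewrite cylinder0 setTI.
rewrite (_ : (fun E => _) =
   fun E => P (cylinder T a t `&` iter t T @^-1` (a t `&` T @^-1` E))).
  apply: (admissible_le KL).
  have it : itinerary A a t by move=> j jt; exact/Aa/ltnW.
  have := admissible_branch (IH it) (Aa t (ltnSn t)); exact.
by apply/funext => E; rewrite cylinderS preimage_setI setIA.
Qed.

Lemma le_on_determined t G m m' : countably_additive m ->
  countably_additive m' -> measurable G -> determined T A t G ->
  (forall a, itinerary A a t ->
    m (cylinder T a t) <= m' (cylinder T a t)) ->
  m G <= m' G.
Proof.
move=> cm cm' mG dG mm'.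
apply: (le_on_cylinders GM cm cm' mG mG (t := t)) => a Aa.
have [/setIidPr ->|aG] := determined_cylinder dG Aa; first exact: mm'.
by rewrite setIC aG (countably_additive0 cm) (countably_additive0 cm').
Qed.

Lemma countably_additive_restrictC m G : countably_additive m -> measurable G ->
  countably_additive (fun E => m (E `&` G)).
Proof.
move=> cm mG; rewrite (_ : (fun E => _) = fun E => m (G `&` E)).
  exact: countably_additive_restrict.
by apply/funext => E; rewrite setIC.
Qed.

(** For a single t-cylinder, iterate [admissible_branch]; a general G is a
    disjoint union of t-cylinders and the inequality defining [regular] can be
    summed. *)
Lemma admissible_determined t G : measurable G -> determined T A t G ->
  admissible K (fun E => P (G `&` iter t T @^-1` E)).
Proof.
move=> mG dG.
have mi E : measurable E -> measurable (iter t T @^-1` E).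
  exact: (measurable_iter_preimage GM).
split=> [|E mE|].
- have := countably_additive_preimage (measurable_fun_iter GM t)
    (countably_additive_restrict Pca mG); exact.
- by apply: P0; apply: measurableI => //; exact: mi.
move=> q Q E F q0 cQ mE mF EQ FQ.
have cE H (r : R) : measurable H ->
    countably_additive (fun S => r * P (S `&` iter t T @^-1` H)).
  move=> /mi mH; apply: countably_additive_scale.
  exact: countably_additive_restrictC.
rewrite [leLHS]mulrC mulrA mulrAC.
apply: (le_on_determined (cE E (P F) mE)
  (cE F (expR (K * lambda ^+ q) * P E) mF) mG dG) => a Aa.
have [_ _ /(_ q Q E F q0 cQ mE mF EQ FQ)] := admissible_cylinder Aa.
by rewrite mulrC -mulrA [P E * _]mulrC.
Qed.

(** This is where big images enter.  By distortion,
    mu (a `&` T^-1 E) / mu a is at most exp (L lambda) mu E / mu (T a), and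
    mu (T a) > C.  Regularity on the 1-cylinder a then passes from mu to m. *)
Lemma branch_upper_bound : exists2 c : R, 1 <= c &
  forall m a E, admissible K m -> A a -> measurable E ->
    m (a `&` T @^-1` E) <= c * (m a * P E).
Proof.
case: (GM) => _ _ _ _ [[C C0 CT] _ _].
pose e := expR (L * lambda ^+ 1); pose e' := expR (K * lambda ^+ 1).
have e0 : 0 < e by exact: expR_gt0.
have e'0 : 0 < e' by exact: expR_gt0.
exists (1 + e' * (e / C)).
  by rewrite lerDl mulr_ge0 ?divr_ge0 ?ltW.
move=> m a E [cm m0 rm] Aa mE.
have ma := mA Aa; have mTa := measurable_image Aa.
have [|rho rho0 rhoP] := BD (n := 1) Aa mTa (@subset_refl _ _).
  by move=> x y ax _ ay _; exists a; split=> //; exact: cylinders1.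
have mE' : measurable (a `&` T @^-1` E).
  by apply: measurableI => //; exact: measurable_preimage.
have Pa := gm_pos GM Aa; rewrite -/(P a) in Pa.
have CP : C < P (T @` a) by rewrite -lte_fin probability_fineK//; exact: CT.
have rhoa : rho * C <= P a.
  have /andP[+ _] := rhoP _ mTa (@subset_refl _ _).
  rewrite (setIidl (@preimage_image _ _ _ _)); apply: le_trans.
  by rewrite ler_wpM2l ?ltW.
have PaE : P (a `&` T @^-1` E) <= e / C * (P a * P E).
  have aET : a `&` T @^-1` E = a `&` T @^-1` (E `&` T @` a).
    by apply/seteqP; split=> x [ax]; [move=> Ex; split=> //; split=> //; exists x|case].
  have mEa : measurable (E `&` T @` a) by exact: measurableI.
  have /andP[_ +] := rhoP _ mEa (@subIsetr _ _ _).
  rewrite -aET -/e => /le_trans; apply.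
  rewrite -mulrA ler_wpM2l ?(ltW e0)// mulrA.
  apply: ler_pM; [exact: ltW|exact: P0| |].
    by rewrite mulrC ler_pdivlMr.
  by apply: countably_additive_le => //; exact: subIsetl.
have := rm 1 a _ a isT (cylinders1 Aa) mE' ma (@subIsetl _ _ _) (@subset_refl _ _).
rewrite -/e' -/(P a) => rma.
have maE : m (a `&` T @^-1` E) <= e' * (e / C) * (m a * P E).
  rewrite -(ler_pM2r Pa) (le_trans rma)//.
  rewrite (_ : _ * P a = e' * (m a * (e / C * (P a * P E)))); last by ring.
  by rewrite ler_wpM2l ?(ltW e'0)// ler_wpM2l// m0.
apply: (le_trans maE); rewrite ler_wpM2r ?mulr_ge0 ?m0 ?P0//.
by rewrite lerDr.
Qed.

Variable c : R.
Hypothesis c1 : 1 <= c.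
Hypothesis cP : forall m a E, admissible K m -> A a -> measurable E ->
    m (a `&` T @^-1` E) <= c * (m a * P E).

Lemma preimage_upper_bound m E : admissible K m -> measurable E ->
  m (T @^-1` E) <= c * (m setT * P E).
Proof.
move=> am mE; case: (am) => cm m0 _.
have [S [pS SA _]] := gm_enumeration GM.
rewrite [m setT * _]mulrC mulrA.
apply: (le_countably_additive cm (countably_additive_scale (c * P E) cm)
  (measurable_preimage mT mE) measurableT pS) => i.
have [->|ASi] := SA i; first by rewrite !setI0 (countably_additive0 cm) mulr0.
by rewrite setTI setIC (le_trans (cP am ASi mE))// [m _ * _]mulrC mulrA.
Qed.

(** One half of psi-mixing: conditioning on the first t symbols multiplies the
    probability of later events by at most c. *)
Lemma determined_upper_bound t G E : measurable G -> determined T A t G ->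
  measurable E -> P (G `&` iter t T @^-1` E) <= c * (P G * P E).
Proof.
move=> mG dG mE; rewrite [P G * _]mulrC mulrA.
have mi : measurable (iter t T @^-1` E) by exact: (measurable_iter_preimage GM).
apply: (le_on_determined (countably_additive_restrictC Pca mi)
  (countably_additive_scale (c * P E) Pca) mG dG) => a.
case: t mi dG => [|t] mi dG Aa.
  rewrite cylinder0 setTI /=.
  have -> : P setT = 1 by rewrite /fprob probability_setT.
  by rewrite mulr1 ler_peMl// P0.
have it : itinerary A a t by move=> j jt; exact/Aa/ltnW.
have := cP (admissible_cylinder it) (Aa t (ltnSn t)) mE.
rewrite preimage_setI setIA -cylinderS => /le_trans; apply.
by rewrite [leRHS]mulrC mulrCA.
Qed.

End RegularClass.

(** * Doeblin minorization *)

Section FiniteSums.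
Context d {X : measurableType d} {R : realType}.
Implicit Types (m : set X -> R) (E : set X) (F : nat -> set X).

Lemma countably_additive_sum (ms : nat -> set X -> R) n :
  (forall j, countably_additive (ms j)) ->
  countably_additive (fun E => \sum_(j < n) ms j E).
Proof.
move=> cms; elim: n => [|n IH].
  have := countably_additive_scale 0 (cms 0%N).
  by congr countably_additive; apply/funext => E; rewrite mul0r big_ord0.
have := countably_additive_comb 1 1 IH (cms n).
by congr countably_additive; apply/funext => E; rewrite !mul1r big_ord_recr.
Qed.

Lemma countably_additive_head_tail m F n : countably_additive m ->
  measurable_partition F ->
  m setT = \sum_(i < n) m (F i) + m (~` (\bigcup_(i in `I_n) F i)).
Proof.
move=> cm [mF tF cF]; elim: n => [|n IH].
  by rewrite big_ord0 II0 bigcup_set0 setC0 add0r.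
have mU k : measurable (~` (\bigcup_(i in `I_k) F i)).
  by apply: measurableC; exact: bigcup_measurable.
rewrite big_ord_recr/= -addrA {}IH; congr (_ + _).
have [add _] := cm; rewrite (add _ (F n))//; congr (m _ + m _).
  apply/setIidPr => x Fnx [i /= ilt Fix]; have := tF i n I I.
  by move=> /(_ (ex_intro _ x (conj Fix Fnx))) iE; move: ilt; rewrite iE ltnn.
apply/seteqP; split=> [x [nx nF] [i /= ]|x nx].
  rewrite ltnS leq_eqVlt => /predU1P[->//|il Fix]; apply: nx.
  by exists i.
split=> [[i /= il Fix]|Fnx]; apply: nx; first by exists i => //=; exact: ltnW.
by exists n => /=.
Qed.

Lemma countably_additive_le_sum m E F n : countably_additive m ->
  nonneg_on_measurable m -> measurable E -> (forall i, measurable (F i)) ->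
  (forall x, E x -> exists2 i, (i < n)%N & F i x) ->
  m E <= \sum_(i < n) m (E `&` F i).
Proof.
move=> cm m0 + mF; elim: n E => [|n IH] E mE EF.
  rewrite big_ord0 (_ : E = set0) ?(countably_additive0 cm)//.
  by apply/seteqP; split=> // x /EF[].
have [add _] := cm.
rewrite big_ord_recr/= [leLHS](add E (F n))// [leLHS]addrC lerD2r.
have mD : measurable (E `\` F n) by exact: measurableD.
apply: (le_trans (IH _ mD _)) => [x [/EF[i + Fix] nF]|].
  rewrite ltnS leq_eqVlt => /predU1P[iE|il]; last by exists i.
  by move: nF; rewrite -iE.
apply: ler_sum => i _; apply: countably_additive_le => //.
- exact: measurableI.
- exact: measurableI.
- by apply: setSI; exact: subDsetl.
Qed.

(** Constants that can be weakened may be chosen the same for finitely many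
    indices. *)
Lemma finite_uniform (Q : nat -> R -> nat -> Prop) n :
  (forall i eta eta' J J', 0 < eta' -> eta' <= eta -> (J <= J')%N ->
     Q i eta J -> Q i eta' J') ->
  (forall i, exists2 eta, 0 < eta & exists J, Q i eta J) ->
  exists2 eta, 0 < eta & exists J, forall i, (i < n)%N -> Q i eta J.
Proof.
move=> Qmono Qex; elim: n => [|n [eta eta0 [J QJ]]].
  by exists 1 => //; exists 0%N.
have [eta' eta'0 [J' QJ']] := Qex n.
have min0 : 0 < Num.min eta eta' by rewrite lt_min eta0.
exists (Num.min eta eta') => //; exists (maxn J J') => i.
rewrite ltnS leq_eqVlt => /predU1P[->|il].
  by apply: Qmono QJ' => //; rewrite ?ge_min ?lexx ?orbT// leq_maxr.
by apply: Qmono (QJ i il) => //; rewrite ?ge_min ?lexx ?orbT// leq_maxl.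
Qed.

End FiniteSums.

Section Doeblin.
Context d {X : measurableType d} {R : realType}.
Variables (mu : probability X R) (T : X -> X) (A : set (set X)) (lambda : R).
Hypothesis GM : gibbs_markov mu T A lambda.
Hypothesis ergT : ergodic mu T.
Local Notation P := (fprob mu).
Implicit Types (E F G : set X) (m : set X -> R).

Let mT := gm_measurableT GM.
Let l01 := gm_lambda GM.
Let l0 : 0 < lambda. Proof. by case/andP: l01. Qed.
Let mA := gm_measurable GM.
Let P0 := @fine_probability_ge0 _ _ _ mu.
Let Pca := @countably_additive_probability _ _ _ mu.
Let mpre t E : measurable E -> measurable (iter t T @^-1` E).
Proof. exact: (measurable_iter_preimage GM). Qed.

Lemma fine_probabilityT : P setT = 1.
Proof. by rewrite /fprob probability_setT. Qed.

(** The set of points that visit b infinitely often is T-invariant, and its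
    measure is at least mu b > 0; by ergodicity almost every point of a
    visits b. *)
Lemma partition_transition a b : A a -> A b ->
  exists2 j, (0 < j)%N & 0 < P (a `&` iter j T @^-1` b).
Proof.
move=> Aa Ab; have mb := mA Ab; have ma := mA Aa.
pose V k := iter k T @^-1` b; pose W := lim_sup_set V.
have mV k : measurable (V k) by exact: mpre.
have mVU n : measurable (\bigcup_(k in [set k | (n <= k)%N]) V k).
  by apply: bigcup_measurable => k _; exact: mV.
have mW : measurable W by apply: bigcapT_measurable => n; exact: mVU.
have TW : T @^-1` W = W.
  apply/seteqP; split=> x Wx n _.
    have [k /= nk Vk] := Wx n I; exists k.+1; first by rewrite /= (leq_trans nk).
    by rewrite /V/preimage/= -iterS iterSr.
  have [[//|k] /= nk Vk] := Wx n.+1 I; exists k => //.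
  by rewrite /V/preimage/= -iterSr.
have Wb : (mu b <= mu W)%E.
  have cW : mu (\bigcup_(k in [set k | (n <= k)%N]) V k) @[n --> \oo] --> mu W.
    apply: lim_sup_set_cvg => //; apply: le_lt_trans (ltry 1).
    exact: probability_le1.
  rewrite -(cvg_lim _ cW)//; apply: lime_ge; first by apply/cvg_ex; exists (mu W).
  near=> n; rewrite -probability_fineK// -(probability_iter_preimage GM n mb).
  rewrite probability_fineK//; last exact: mV.
  apply: le_measure; rewrite ?inE.
  - exact: mV.
  - exact: mVU.
  - by move=> x Vx; exists n => /=.
have W1 : mu W = 1%E.
  case: (ergT mW TW) => // W0; move: Wb; rewrite W0 -probability_fineK// lee_fin.
  by rewrite leNgt (gm_pos GM Ab).
have PW : P a = P (a `&` W).
  have [add _] := Pca; rewrite (add a W)//= [X in _ + X = _](_ : _ = 0) ?addr0//.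
  apply/eqP; rewrite eq_le P0 ?andbT; last exact: measurableD.
  have -> : (0 : R) = P (~` W) by rewrite /fprob probability_setC// W1 subee.
  apply: countably_additive_le => //; [exact: measurableD|exact: measurableC].
apply: contrapT => noj; have : P (a `&` W) = 0; last first.
  by rewrite -PW => /eqP; rewrite gt_eqF// (gm_pos GM Aa).
have neg : mu.-negligible (\bigcup_k (a `&` V k.+1)).
  apply: negligible_bigcup => k.
  have mk : measurable (a `&` V k.+1) by exact: measurableI.
  apply/negligibleP => //; apply: (etrans (esym (probability_fineK mu mk))).
  congr EFin.
  apply/eqP; rewrite eq_le P0// andbT leNgt; apply/negP => pos.
  by apply: noj; exists k.+1.
have mI : measurable (a `&` W) by exact: measurableI.
have : mu.-negligible (a `&` W).
  apply: negligibleS neg => x [ax /(_ 1%N I)[[//|k] _ Vk]].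
  by exists k.
by move=> /(measure_negligible mI); rewrite /fprob => ->.
Unshelve. all: by end_near. Qed.

Variables L K theta c : R.
Hypothesis L0 : 0 <= L.
Hypothesis BD : distortion_bound mu T A lambda L.
Hypothesis K0 : 0 <= K.
Hypothesis theta0 : 0 < theta.
Hypothesis KL : (1 + theta) * (lambda * (K + L)) <= K.
Hypothesis c1 : 1 <= c.
Hypothesis cP : forall m a E, admissible mu T A lambda K m -> A a ->
  measurable E -> m (a `&` T @^-1` E) <= c * (m a * P E).

Let adm := admissible mu T A lambda.

Let KL1 : lambda * (K + L) <= K.
Proof.
have : 0 <= lambda * (K + L) by rewrite mulr_ge0 ?addr_ge0// ltW.
by move=> /(mulr_ge0 (ltW theta0)); move: KL; rewrite mulrDl mul1r; lra.
Qed.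

(** Mass in a spreads to b after j steps and then over T b.  Regularity on the
    1-cylinders a and b makes the spreading uniform in m and E. *)
Lemma partition_minorization a b : A a -> A b ->
  exists2 eta, 0 < eta & exists J, forall m E, adm K m -> measurable E ->
    eta * (m a * P (E `&` T @` b)) <= \sum_(j < J) m (iter j.+1 T @^-1` E).
Proof.
move=> Aa Ab; have [j j0 Wb] := partition_transition Aa Ab.
have ma := mA Aa; have mb := mA Ab; have mTb := measurable_image GM Ab.
pose W E := P (a `&` iter j T @^-1` E).
have aW : adm K W.
  apply: (admissible_determined GM BD K0 KL1 ma).
  apply: (determined_le j0); apply: determined_union_of; first exact: gm_trivIset GM.
  exists [set a]; last by rewrite bigcup_set1.
  by move=> _ ->; exact: (cylinders1 GM Aa).
have [|rho rho0 rhoP] := BD (n := 1) Ab mTb (@subset_refl _ _).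
  by move=> x y bx _ by_ _; exists b; split=> //; exact: (cylinders1 GM Ab).
have Pa := gm_pos GM Aa; have Pb := gm_pos GM Ab; rewrite -/(P a) in Pa.
rewrite -/(P b) in Pb.
pose e := expR (K * lambda ^+ 1); have e0 : 0 < e by exact: expR_gt0.
exists (W b * rho / (e * e * P a * P b)).
  by rewrite divr_gt0 ?mulr_gt0.
exists j.+1 => m E [cm m0 rm] mE.
have mTE := measurable_preimage mT mE.
have mS : measurable (a `&` iter j T @^-1` (b `&` T @^-1` E)).
  by apply: measurableI => //; apply: mpre; exact: measurableI.
have r1 := rm 1 a _ _ isT (cylinders1 GM Aa) ma mS (@subset_refl _ _)
  (@subIsetl _ _ _).
have mbE : measurable (b `&` T @^-1` E) by exact: measurableI.
have [_ W0 rW] := aW.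
have r2 := rW 1 b _ _ isT (cylinders1 GM Ab) mb mbE (@subset_refl _ _)
  (@subIsetl _ _ _).
rewrite -/e in r1 r2.
have r3 : rho * P (E `&` T @` b) <= P (b `&` T @^-1` E).
  have mEb : measurable (E `&` T @` b) by exact: measurableI.
  have /andP[+ _] := rhoP _ mEb (@subIsetr _ _ _).
  move=> /le_trans; apply; apply: (countably_additive_le Pca P0) => //.
    by apply: measurableI => //; exact: measurable_preimage.
  by move=> x [bx []].
apply: (@le_trans _ _ (m (iter j.+1 T @^-1` E))); last first.
  rewrite (bigD1 ord_max)//= lerDl; apply: sumr_ge0 => i _.
  exact/m0/mpre.
apply: (@le_trans _ _ (m (a `&` iter j T @^-1` (b `&` T @^-1` E)))); last first.
  apply: (countably_additive_le cm m0) => //; first exact: mpre.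
  by move=> x [_ []].
rewrite -(ler_pM2l (mulr_gt0 (mulr_gt0 (mulr_gt0 e0 e0) Pa) Pb)).
rewrite (_ : _ * (_ * _) = m a * (W b * (rho * P (E `&` T @` b)))); last first.
  by field; rewrite !gt_eqF.
apply: (le_trans (y := m a * (e * (W (b `&` T @^-1` E) * P b)))).
  rewrite ler_wpM2l ?m0//; apply: le_trans r2.
  by rewrite ler_wpM2l ?W0.
rewrite (_ : m a * _ = (e * P b) * (m a * W (b `&` T @^-1` E))); last by ring.
rewrite (_ : e * e * P a * P b * _ = (e * P b) *
  (e * (m (a `&` iter j T @^-1` (b `&` T @^-1` E)) * P a))); last by ring.
by rewrite ler_wpM2l ?mulr_ge0// ltW.
Qed.

Lemma small_tail (F : nat -> set X) delta : measurable_partition F -> 0 < delta ->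
  exists n, P (~` (\bigcup_(i in `I_n) F i)) < delta.
Proof.
move=> pF delta0; have [_ /(_ _ _ measurableT pF)] := Pca.
rewrite -/(P setT) fine_probabilityT => /cvgrPdist_lt/(_ _ delta0)[n _ /(_ n)].
move=> /(_ (leqnn n)) /= near1; exists n; move: near1.
have := countably_additive_head_tail n Pca pF.
rewrite -/(P setT) fine_probabilityT -/(P _) => PE.
have s0 : 0 <= P (~` (\bigcup_(i in `I_n) F i)).
  apply: P0; apply: measurableC; apply: bigcup_measurable => i _.
  by case: pF => mF _ _; exact: mF.
under eq_bigr do rewrite setTI; rewrite {1}PE addrAC subrr add0r.
by rewrite ger0_norm.
Qed.

(** Finitely many images T (F i) cover the space.  If b met none of the images of
    the first n elements, T^-1 b would lie in the tail of the partition, and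
    mu b = mu (tail `&` T^-1 b) <= c mu(tail) mu b < mu b. *)
Lemma image_cover (F : nat -> set X) : measurable_partition F ->
  (forall i, F i = set0 \/ A (F i)) ->
  exists n, forall x, exists2 i, (i < n)%N & (T @` F i) x.
Proof.
move=> pF FA; have c0 : 0 < c by apply: lt_le_trans c1.
have c0' : 0 < c^-1 by rewrite invr_gt0.
have [n tail] := small_tail pF c0'; exists n => x; apply: contrapT => nx.
have [b Ab bx] := gm_cover GM x; have mb := mA Ab.
set G := ~` _ in tail.
have mG : measurable G.
  apply: measurableC; apply: bigcup_measurable => i _.
  by case: pF => mF _ _; exact: mF.
have dG : determined T A 1 G.
  move=> y z /same_cylinderP/(_ 0%N isT)[a Aa [ay az]] Gy [i /= iln Fiz].
  apply: Gy; exists i => //.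
  have [F0|AF] := FA i; first by rewrite F0 in Fiz.
  by rewrite (gm_eq GM AF Aa Fiz az).
have bG : T @^-1` b `<=` G.
  move=> y by_ [i /= iln Fiy]; apply: nx; exists i => //.
  have [F0|AF] := FA i; first by rewrite F0 in Fiy.
  apply: (partition_sub_image GM AF Ab) => //.
  by exists (T y); split=> //; exists y.
have := determined_upper_bound GM BD K0 KL1 c1 cP mG dG mb.
have Pb := gm_pos GM Ab; rewrite -/(P b) in Pb.
rewrite /= (setIidr bG) (probability_preimage GM mb) -/(P _) -/(P b) mulrA.
rewrite ler_pMl// leNgt => /negP; apply.
by rewrite -ltr_pdivlMl// mulr1.
Qed.

(** After one step half of the mass of m lies in finitely many elements F i,
    i < n0, because the push-forward of m is bounded by c m(X) mu.  From there
    it reaches finitely many elements F i', i' < n1, whose images cover the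
    space.  The constants involved range over the finite set of pairs (i, i').
    The iterates start at j + 2 for this first step and for the last one. *)
Lemma minorization : exists2 eta, 0 < eta & exists2 J, (0 < J)%N &
  forall m E, adm K m -> measurable E ->
    eta * (m setT * P E) <= \sum_(j < J) m (iter j.+2 T @^-1` E).
Proof.
have [F [pF FA _]] := gm_enumeration GM; have [mF _ _] := pF.
have c0 : 0 < c by apply: lt_le_trans c1.
have [n1 Fcov] := image_cover pF FA.
have c20 : 0 < (2 * c)^-1 by rewrite invr_gt0 mulr_gt0.
have [n0 tail] := small_tail pF c20.
have mTF i : measurable (T @` F i).
  by have [->|/(measurable_image GM)//] := FA i; rewrite image_set0.
have [||eta eta0 [J EJ]] := @finite_uniform R (fun i eta J => forall i',
    (i' < n1)%N -> forall m E, adm K m -> measurable E ->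
    eta * (m (F i) * P (E `&` T @` F i')) <=
    \sum_(j < J) m (iter j.+1 T @^-1` E)) n0.
- move=> i eta eta' J J' eta'0 le_eta le_J EJ i' i'n m E am mE.
  have [cm m0 _] := am.
  apply: (le_trans (y := eta * (m (F i) * P (E `&` T @` F i')))).
    rewrite ler_wpM2r// mulr_ge0 ?m0// P0//; exact: measurableI.
  apply: (le_trans (EJ i' i'n m E am mE)).
  rewrite -(subnKC le_J) big_split_ord/= lerDl.
  by apply: sumr_ge0 => j _; exact/m0/mpre.
- move=> i; apply: finite_uniform.
    move=> i' eta eta' J J' eta'0 le_eta le_J EJ m E am mE.
    have [cm m0 _] := am.
    apply: (le_trans (y := eta * (m (F i) * P (E `&` T @` F i')))).
      rewrite ler_wpM2r// mulr_ge0 ?m0// P0//; exact: measurableI.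
    apply: (le_trans (EJ m E am mE)).
    rewrite -(subnKC le_J) big_split_ord/= lerDl.
    by apply: sumr_ge0 => j _; exact/m0/mpre.
  move=> i'.
  have [Fi|AFi] := FA i.
    exists 1 => //; exists 0%N => m E [cm _ _] _.
    by rewrite Fi (countably_additive0 cm) mul0r mulr0 big_ord0.
  have [Fi'|AFi'] := FA i'; last exact: partition_minorization.
  exists 1 => //; exists 0%N => m E _ _.
  by rewrite Fi' image_set0 setI0 (countably_additive0 Pca) !mulr0 big_ord0.
have nn0 : 0 < 2 * (n0%:R + 1) * (n1%:R + 1) :> R.
  by rewrite !mulr_gt0// ltr_wpDl.
exists (eta / (2 * (n0%:R + 1) * (n1%:R + 1))); first by rewrite divr_gt0.
exists J.+1 => // m E am mE; have am1 := admissible_preimageK GM BD KL1 am.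
have [cm m0 _] := am; have [cm1 m10 _] := am1.
pose m1 E := m (T @^-1` E); rewrite -/m1 in am1 cm1 m10.
set S := \sum_(j < J) m1 (iter j.+1 T @^-1` E).
have S0 : 0 <= S by apply: sumr_ge0 => j _; exact/m10/mpre.
have half : m setT <= 2 * \sum_(i < n0) m1 (F i).
  have mG : measurable (~` (\bigcup_(i in `I_n0) F i)).
    by apply: measurableC; exact: bigcup_measurable.
  have tle : m1 (~` (\bigcup_(i in `I_n0) F i)) <=
      c * (m setT * P (~` (\bigcup_(i in `I_n0) F i))).
    exact: (preimage_upper_bound GM cP am mG).
  have ht : m setT = \sum_(i < n0) m1 (F i) + m1 (~` (\bigcup_(i in `I_n0) F i)).
    exact: (countably_additive_head_tail n0 cm1 pF).
  have : c * (m setT * P (~` (\bigcup_(i in `I_n0) F i))) <= m setT / 2.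
    rewrite mulrCA ler_wpM2l ?m0// -ler_pdivlMl// (le_trans (ltW tail))//.
    by rewrite invfM mulrC.
  lra.
have Fi i : (i < n0)%N -> eta * (m1 (F i) * P E) <= n1%:R * S.
  move=> il; apply: (le_trans (y := eta * (m1 (F i) *
      \sum_(i' < n1) P (E `&` T @` F i')))).
    rewrite ler_wpM2l ?(ltW eta0)// ler_wpM2l ?m10//.
    apply: (@countably_additive_le_sum _ _ _ P E (fun i => T @` F i)) => //.
  rewrite mulr_natl 2!mulr_sumr -[n1 in _ *+ n1]card_ord -sumr_const.
  by apply: ler_sum => i' _; exact: EJ.
have : eta * ((\sum_(i < n0) m1 (F i)) * P E) <= n0%:R * (n1%:R * S).
  rewrite [leRHS]mulr_natl mulr_suml mulr_sumr -[n0 in _ *+ n0]card_ord -sumr_const.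
  by apply: ler_sum => i' _; exact: Fi.
move=> H; rewrite mulrAC ler_pdivrMr//.
apply: (le_trans (y := 2 * (eta * ((\sum_(i < n0) m1 (F i)) * P E)))).
  by rewrite [leRHS]mulrCA ler_wpM2l ?(ltW eta0)// [leRHS]mulrA ler_wpM2r// P0.
apply: (le_trans (y := 2 * (n0%:R * (n1%:R * S)))); first by rewrite ler_wpM2l.
apply: (le_trans (y := S * (2 * (n0%:R + 1) * (n1%:R + 1)))).
  have n00 : 0 <= n0%:R :> R by []. have n10 : 0 <= n1%:R :> R by [].
  rewrite (_ : 2 * _ = S * (2 * n0%:R * n1%:R)); last by ring.
  by rewrite ler_wpM2l//; nra.
have SE : S = \sum_(j < J) m (iter j.+2 T @^-1` E).
  by apply: eq_bigr => j _; rewrite /m1 -iter_preimageS.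
rewrite ler_wpM2r ?(ltW nn0)// [leRHS]big_ord_recr/= SE lerDl.
exact/m0/mpre.
Qed.

End Doeblin.

(** * Uniform mixing of averages *)

(** Subtracting z from both sides of x <= exp(k) y worsens the ratio, but only by
    a factor 1 + theta in the exponent when z is a small part of y. *)
Lemma expR_subtract (R : realType) (k theta x y z : R) : 0 <= k -> 0 < theta ->
  0 <= z -> (1 + theta) * z <= theta * y -> x <= expR k * y ->
  x - z <= expR ((1 + theta) * k) * (y - z).
Proof.
move=> k0 t0 z0 zy xy.
have ek : 0 < expR k by exact: expR_gt0.
have e1 : expR k - 1 <= expR k * k.
  have := expR_ge1Dx (- k); rewrite expRN => h.
  have := ler_wpM2l (ltW ek) h; rewrite mulfV ?gt_eqF//; lra.
have et : 1 + theta * k <= expR (theta * k) by exact: expR_ge1Dx.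
have e2 : expR k + (expR k - 1) * theta <= expR ((1 + theta) * k).
  rewrite (_ : (1 + theta) * k = k + theta * k); last by ring.
  rewrite expRD; apply: le_trans (ler_wpM2l (ltW ek) et).
  by rewrite mulrDr mulr1 lerD2l mulrCA [leLHS]mulrC ler_wpM2l// ltW.
have yz : z <= theta * (y - z) by lra.
have yz0 : 0 <= y - z by nra.
apply: (le_trans _ (ler_wpM2r yz0 e2)).
have e10 : 0 <= expR k - 1 by rewrite subr_ge0 -expR0 ler_expR.
have := ler_wpM2l e10 yz; nra.
Qed.

Section Mixing.
Context d {X : measurableType d} {R : realType}.
Variables (mu : probability X R) (T : X -> X) (A : set (set X)) (lambda : R).
Hypothesis GM : gibbs_markov mu T A lambda.
Hypothesis ergT : ergodic mu T.
Local Notation P := (fprob mu).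
Implicit Types (E F G : set X) (m : set X -> R).

Let mT := gm_measurableT GM.
Let l01 := gm_lambda GM.
Let l0 : 0 < lambda. Proof. by case/andP: l01. Qed.
Let P0 := @fine_probability_ge0 _ _ _ mu.
Let Pca := @countably_additive_probability _ _ _ mu.
Let mpre t E : measurable E -> measurable (iter t T @^-1` E).
Proof. exact: (measurable_iter_preimage GM). Qed.

Definition decoupling_bound (c : R) :=
  forall t G E, measurable G -> determined T A t G -> measurable E ->
    P (G `&` iter t T @^-1` E) <= c * (P G * P E).

(** Two events E and E' stand for the same long time window, lengthened or
    shortened by N: this absorbs the averages over shifts by at most N, which
    are there because the system may be periodic. *)
Definition mixing_up_to_shift (eps : R) (N : nat) :=
  forall t G E E', measurable G -> determined T A t G ->
    measurable E -> measurable E' ->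
  ((forall j, (j <= N)%N -> iter j T @^-1` E `<=` E') ->
    (1 - eps) * (P G * P E) <= P (G `&` iter t T @^-1` E')) /\
  ((forall j, (j <= N)%N -> E' `<=` iter j T @^-1` E) ->
    P (G `&` iter t T @^-1` E') <= (1 + eps) * (P G * P E)).

Section Constants.
Variables L K theta c : R.
Hypothesis L0 : 0 <= L.
Hypothesis BD : distortion_bound mu T A lambda L.
Hypothesis K0 : 0 <= K.
Hypothesis theta0 : 0 < theta.
Hypothesis KL : (1 + theta) * (lambda * (K + L)) <= K.
Hypothesis c1 : 1 <= c.
Local Notation adm := (admissible mu T A lambda).
Hypothesis cP : forall m a E, adm K m -> A a ->
  measurable E -> m (a `&` T @^-1` E) <= c * (m a * P E).

Let KL0 : 0 <= lambda * (K + L).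
Proof. by rewrite mulr_ge0 ?addr_ge0// ltW. Qed.

Let KL1 : lambda * (K + L) <= K.
Proof.
by move: (mulr_ge0 (ltW theta0) KL0); move: KL; rewrite mulrDl mul1r; lra.
Qed.

(** The averages of m are regular with the constant lambda (K + L), smaller than
    K by the factor 1 + theta.  This margin pays for the subtraction of a small
    part of the lower bound given by [minorization]. *)
Lemma contraction : exists2 eta, 0 < eta < 1 & exists2 J, (0 < J)%N &
  forall m, adm K m -> adm K (fun E =>
    J%:R^-1 * (\sum_(j < J) m (iter j.+2 T @^-1` E)) - eta * (m setT * P E)).
Proof.
have [eta0 eta00 [J J0 min]] := minorization GM ergT L0 BD K0 theta0 KL c1 cP.
have J0' : 0 < J%:R :> R by rewrite ltr0n.
have Ji : 0 < J%:R^-1 :> R by rewrite invr_gt0.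
have eta1 : eta0 / J%:R <= 1.
  have := min P setT (admissible_probability GM K0) measurableT.
  rewrite fine_probabilityT !mulr1 ler_pdivrMr// mul1r => /le_trans; apply.
  rewrite (_ : J%:R = \sum_(j < J) 1); last by rewrite sumr_const card_ord.
  exact: ler_sum.
(* The factor theta / (1 + theta) is the small part required by
   [expR_subtract]. *)
pose eta := eta0 / J%:R * (theta / (1 + theta)).
have t10 : 0 < 1 + theta by rewrite addr_gt0.
exists eta.
  rewrite mulr_gt0 ?divr_gt0//=; apply: le_lt_trans (_ : theta / (1 + theta) < 1).
    by rewrite ler_piMl// divr_ge0// ltW.
  by rewrite ltr_pdivrMr// mul1r ltrDr.
exists J => // m am; have [cm m0 rm] := am.
have avmin E : measurable E -> eta * (1 + theta) / theta * (m setT * P E) <=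
    J%:R^-1 * (\sum_(j < J) m (iter j.+2 T @^-1` E)).
  move=> mE; rewrite -ler_pdivrMl//; apply: le_trans (min m E am mE).
  rewrite invrK mulrA ler_wpM2r//; first by rewrite mulr_ge0 ?m0 ?P0.
  rewrite le_eqVlt; apply/orP; left; apply/eqP; rewrite /eta; field.
  by rewrite !gt_eqF.
have am2 j : adm (lambda * (K + L)) (fun E => m (iter j.+2 T @^-1` E)).
  have := admissible_preimage GM BD (admissible_iter_preimage GM BD KL1 j.+1 am).
  exact.
split.
- have cs : countably_additive (fun E => \sum_(j < J) m (iter j.+2 T @^-1` E)).
    apply: (@countably_additive_sum _ _ _ (fun j E => m (iter j.+2 T @^-1` E))).
    by move=> j; case: (am2 j).
  have := countably_additive_comb J%:R^-1 (- (eta * m setT)) cs Pca.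
  by congr countably_additive; apply/funext => E; rewrite mulNr mulrA.
- move=> E mE; rewrite subr_ge0; apply: le_trans (avmin E mE).
  rewrite ler_wpM2r ?mulr_ge0 ?m0 ?P0// -mulrA ler_peMr//.
    by rewrite /eta mulr_ge0// divr_ge0// ltW// ltW.
  by rewrite ler_pdivlMr// mul1r lerDr.
move=> q Q E F q0 cQ mE mF EQ FQ.
have lq0 : 0 <= lambda ^+ q by rewrite exprn_ge0// ltW.
rewrite !mulrBl.
rewrite (_ : eta * (m setT * P F) * P E = eta * (m setT * P E) * P F);
  last by ring.
apply: (le_trans (y := expR ((1 + theta) * (lambda * (K + L) * lambda ^+ q)) *
  (J%:R^-1 * (\sum_(j < J) m (iter j.+2 T @^-1` F)) * P E -
   eta * (m setT * P E) * P F))); last first.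
  apply: ler_wpM2r; last by rewrite ler_expR mulrA ler_wpM2r.
  rewrite subr_ge0.
  rewrite (_ : eta * (m setT * P E) * P F = eta * (m setT * P F) * P E);
    last by ring.
  rewrite ler_wpM2r ?P0//; apply: le_trans (avmin F mF).
  rewrite ler_wpM2r ?mulr_ge0 ?m0 ?P0// -mulrA ler_peMr//.
    by rewrite /eta mulr_ge0// divr_ge0// ltW// ltW.
  by rewrite ler_pdivlMr// mul1r lerDr.
apply: expR_subtract => //.
- exact: mulr_ge0.
- have e0 : 0 <= eta by rewrite /eta mulr_ge0// divr_ge0// ltW// ltW.
  apply: mulr_ge0; last exact: P0.
  by apply: mulr_ge0 => //; apply: mulr_ge0; [exact: m0|exact: P0].
- have := ler_wpM2l (ltW theta0) (ler_wpM2r (P0 mE) (avmin F mF)).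
  rewrite mulrA; apply: le_trans.
  rewrite le_eqVlt; apply/orP; left; apply/eqP; field.
  by rewrite gt_eqF.
have avr : (\sum_(j < J) m (iter j.+2 T @^-1` E)) * P F <=
    expR (lambda * (K + L) * lambda ^+ q) *
    ((\sum_(j < J) m (iter j.+2 T @^-1` F)) * P E).
  rewrite !mulr_suml mulr_sumr; apply: ler_sum => j _.
  have [_ _ rj] := am2 j; exact: (rj q Q E F q0 cQ mE mF EQ FQ).
rewrite -[leLHS]mulrA; apply: (le_trans (ler_wpM2l (ltW Ji) avr)).
by rewrite le_eqVlt; apply/orP; left; apply/eqP; ring.
Qed.

(** In step k the iterated averages of m equal m' + (1 - (1 - eta)^k) m(X) mu,
    with m' in the class and of total mass (1 - eta)^k m(X); one more push-forward
    bounds m' by c (1 - eta)^k m(X) mu.  The averages themselves are not named: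
    they are compared with m E' for an event E' that contains, or is contained
    in, all the relevant preimages of E. *)
Lemma class_mixing eps : 0 < eps -> exists N, forall m E E', adm K m ->
  measurable E -> measurable E' ->
  ((forall j, (j <= N)%N -> iter j T @^-1` E `<=` E') ->
    (1 - eps) * (m setT * P E) <= m E') /\
  ((forall j, (j <= N)%N -> E' `<=` iter j T @^-1` E) ->
    m E' <= (1 + eps) * (m setT * P E)).
Proof.
move=> eps0; have [eta /andP[eta0 eta1] [J J0 contr]] := contraction.
have J0' : 0 < J%:R :> R by rewrite ltr0n.
have step k : forall m, adm K m -> exists2 m', adm K m' &
    m' setT = (1 - eta) ^+ k * m setT /\
    forall E E', measurable E -> measurable E' ->
  ((forall j, (j <= k * J.+1)%N -> iter j T @^-1` E `<=` E') ->
    m' E + (1 - (1 - eta) ^+ k) * (m setT * P E) <= m E') /\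
  ((forall j, (j <= k * J.+1)%N -> E' `<=` iter j T @^-1` E) ->
    m E' <= m' E + (1 - (1 - eta) ^+ k) * (m setT * P E)).
  elim: k => [|k IH] m am; have [cm m0 _] := am.
    exists m => //; split=> [|E E' mE mE']; first by rewrite expr0 mul1r.
    rewrite expr0 subrr mul0r addr0.
    by split=> /(_ 0%N isT) EE'; apply: (countably_additive_le cm m0).
  have [m' am' [m'T m'P]] := IH m am.
  have [cm' m0' _] := am'.
  exists (fun E => J%:R^-1 * (\sum_(j < J) m' (iter j.+2 T @^-1` E))
                   - eta * (m' setT * P E)); first exact: contr.
  have avc (r : R) : J%:R^-1 * (\sum_(j < J) r) = r.
    by rewrite sumr_const card_ord -[r *+ J]mulr_natl mulKf// gt_eqF.
  split.
    under eq_bigr do rewrite preimage_setT.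
    by rewrite avc fine_probabilityT mulr1 m'T exprS; ring.
  move=> E E' mE mE'.
  have PE j : P (iter j T @^-1` E) = P E by exact: (probability_iter_preimage GM).
  have eqE : forall s : R, J%:R^-1 * s - eta * (m' setT * P E) +
      (1 - (1 - eta) ^+ k.+1) * (m setT * P E) =
      J%:R^-1 * s + (1 - (1 - eta) ^+ k) * (m setT * P E).
    by move=> s; rewrite m'T exprS; ring.
  have bound j i : (j < J)%N -> (i <= k * J.+1)%N ->
      (i + j.+2 <= k.+1 * J.+1)%N.
    by move=> jJ ik; rewrite mulSn addnC leq_add.
  have pre i j : iter i T @^-1` (iter j.+2 T @^-1` E) = iter (i + j.+2) T @^-1` E.
    by apply/funext => x; rewrite /preimage/= -!iterS -iterD addnC.
  rewrite eqE; split=> EE'.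
    rewrite -[leRHS]avc -[X in _ + X]avc -mulrDr -big_split/=.
    rewrite ler_wpM2l ?invr_ge0 ?(ltW J0')//; apply: ler_sum => j _.
    rewrite -(PE j.+2); have [+ _] := m'P _ _ (mpre j.+2 mE) mE'; apply.
    by move=> i ik; rewrite pre; apply/EE'/bound.
  rewrite -[leLHS]avc -[X in _ + X]avc -mulrDr -big_split/=.
  rewrite ler_wpM2l ?invr_ge0 ?(ltW J0')//; apply: ler_sum => j _.
  rewrite -(PE j.+2); have [_ +] := m'P _ _ (mpre j.+2 mE) mE'; apply.
  by move=> i ik; rewrite pre; apply/EE'/bound.
have c0 : 0 < c by apply: lt_le_trans c1.
have [k kP] : exists k, c * (1 - eta) ^+ k <= eps.
  have e1 : `|1 - eta| < 1 by rewrite ger0_norm; lra.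
  have /cvgrPdist_le/(_ _ eps0)[k _ /(_ k (leqnn k))] := cvg_geometric c e1.
  rewrite /= sub0r normrN ger0_norm; first by exists k.
  rewrite mulr_ge0 ?(ltW c0)// exprn_ge0//; lra.
exists (k * J.+1).+1 => m E E' am mE mE'; have [cm m0 _] := am.
have [m' am' [m'T m'P]] := step k m am; have [cm' m0' _] := am'.
have mTE := measurable_preimage mT mE.
have PTE : P (T @^-1` E) = P E by exact: (probability_preimage GM).
have up := preimage_upper_bound GM cP am' mE; rewrite m'T in up.
have s0 : 0 <= m setT * P E by rewrite mulr_ge0 ?m0 ?P0.
have q0 : 0 <= (1 - eta) ^+ k by rewrite exprn_ge0//; lra.
have qe : (1 - eta) ^+ k <= eps.
  by apply: le_trans kP; rewrite ler_peMl.
have := ler_wpM2r s0 kP; have := ler_wpM2r s0 qe.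
have := mulr_ge0 q0 s0; have := m0' _ mTE; move: up.
have [lo hi] := m'P _ _ mTE mE'; rewrite PTE in lo hi.
set q := (1 - eta) ^+ k in lo hi *; set s := m setT * P E in lo hi *.
have pre j : iter j T @^-1` (T @^-1` E) = iter j.+1 T @^-1` E by [].
move=> up m'0 qs qes ces; split=> EE'.
  apply: (le_trans _ (lo _)); last by move=> j jk; rewrite pre; exact: EE'.
  lra.
apply: (le_trans (hi _)); first by move=> j jk; rewrite pre; exact: EE'.
have : c * (q * m setT * P E) = c * q * s by rewrite /s; ring.
lra.
Qed.

End Constants.

Lemma block_mixing : exists2 c : R, 1 <= c & decoupling_bound c /\
  (forall eps : R, 0 < eps -> exists N, mixing_up_to_shift eps N).
Proof.
have /andP[_ l1] := l01.
have [L L0 BD] := branch_distortion GM.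
(* K and theta solve (1 + theta) lambda (K + L) = K, with
   1 + theta = (1 + lambda) / (2 lambda). *)
pose theta := (1 - lambda) / (2 * lambda).
have theta0 : 0 < theta by rewrite divr_gt0 ?subr_gt0 ?mulr_gt0.
pose K := L * (1 + lambda) / (1 - lambda).
have K0 : 0 <= K.
  by rewrite divr_ge0 ?mulr_ge0 ?subr_ge0 ?addr_ge0 ?(ltW l0) ?(ltW l1).
have KL : (1 + theta) * (lambda * (K + L)) <= K.
  rewrite le_eqVlt; apply/orP; left; apply/eqP; rewrite /theta /K; field.
  by rewrite !gt_eqF ?subr_gt0.
have [c c1 cP] := branch_upper_bound GM BD K.
have KL1 : lambda * (K + L) <= K.
  have : 0 <= lambda * (K + L) by rewrite mulr_ge0 ?addr_ge0// ltW.
  by move=> /(mulr_ge0 (ltW theta0)); move: KL; rewrite mulrDl mul1r; lra.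
exists c => //; split=> [t G E mG dG mE|eps eps0].
  exact: (determined_upper_bound GM BD K0 KL1 c1 cP).
have [N NP] := class_mixing L0 BD K0 theta0 KL c1 cP eps0.
exists N => t G E E' mG dG mE mE'.
have aG := admissible_determined GM BD K0 KL1 mG dG.
by have := NP _ _ _ aG mE mE'; rewrite preimage_setT setIT.
Qed.

End Mixing.

(** * Survival probabilities *)

Section Avoid.
Context {X : Type} (T : X -> X) (A : set (set X)) (U : set X).

(** The times run over 0 <= j < t, whereas entry times start at 1:
    tau > t is the preimage under T of avoiding U for t steps. *)
Definition avoid (t : nat) : set X :=
  [set x | forall j, (j < t)%N -> ~ U (iter j T x)].

Lemma avoid0 : avoid 0 = setT.
Proof. by apply/seteqP; split. Qed.

Lemma avoidD s t : avoid (s + t) = avoid s `&` iter s T @^-1` avoid t.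
Proof.
apply/seteqP; split=> [x ax|x [ax bx] j jst].
  split=> j jlt; first by apply: ax; exact: ltn_addr.
  by rewrite -iterD addnC; apply: ax; rewrite ltn_add2l.
have [/ax//|sj] := ltnP j s.
by rewrite -(subnK sj) iterD; apply: bx; rewrite ltn_subLR.
Qed.

Lemma avoidS t : avoid t.+1 = ~` U `&` T @^-1` avoid t.
Proof.
rewrite -add1n avoidD; congr (_ `&` _).
by apply/seteqP; split=> [x /(_ 0%N isT)//|x nx [|//]].
Qed.

Lemma avoidSr t : avoid t.+1 = avoid t `&` ~` (iter t T @^-1` U).
Proof. by rewrite -addn1 avoidD avoidS avoid0 preimage_setT setIT. Qed.

Lemma avoid_le s t : (s <= t)%N -> avoid t `<=` avoid s.
Proof. by move=> st x ax j js; apply: ax; exact: leq_trans st. Qed.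

Lemma determined_avoid t k : determined T A k U ->
  determined T A (t + k) (avoid t).
Proof.
move=> dU x y xy ax j jt Uy; apply: (ax j jt); apply: dU Uy.
apply: same_cylinder_sym; apply: same_cylinder_iter.
by apply: same_cylinder_le xy; rewrite leq_add2r ltnW.
Qed.

End Avoid.

Section EntryTimeEvents.
Context d {X : measurableType d} (T : X -> X) (U : set X).

Lemma tau_gtP (R : realType) (t : R) x : tau_gt T U t x <->
  forall j, (0 < j)%N -> j%:R <= t -> ~ U (iter j T x).
Proof.
rewrite /tau_gt/= /entry_time; case: pselect => [h|nh] /=; last first.
  split=> [_ j j0 _ Uj|_]; last by rewrite ltry.
  by apply: nh; exists j; rewrite j0; apply/asboolP.
case: ex_minnP => m /andP[m0 /asboolP Um] minm; rewrite lte_fin.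
split=> [tm j j0 jt Uj|/(_ m m0) nU].
  have mj : (m <= j)%N by apply: minm; rewrite j0; apply/asboolP.
  by move: tm; rewrite ltNge (le_trans _ jt)// ler_nat.
by rewrite ltNge; apply/negP => mt; exact: nU.
Qed.

Lemma tau_gt_avoid (R : realType) (t : R) : 0 <= t ->
  tau_gt T U t = T @^-1` avoid T U (Num.truncn t).
Proof.
move=> t0; apply/seteqP; split=> [x /tau_gtP ax j jt|x ax].
  rewrite -iterSr; apply: ax => //.
  by rewrite -truncn_gt_nat.
apply/tau_gtP => -[//|j] _ jt; rewrite iterSr; apply: ax.
by rewrite truncn_gt_nat.
Qed.

Lemma tau_gt_nat (R : realType) (k : nat) :
  tau_gt T U (k%:R : R) = T @^-1` avoid T U k.
Proof. by rewrite tau_gt_avoid// natrK. Qed.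

Lemma tau_iter_le1 (R : realType) (k : nat) :
  @tau_iter_le d X R T U 1 k = ~` (tau_gt T U (k%:R : R)).
Proof.
apply/seteqP; split=> x; rewrite /tau_iter_le/tau_gt/=;
  case: (entry_time T U x) => [m|] /=; rewrite ?add0n.
- by rewrite leNgt => /negP.
- by rewrite leye_eq.
- by move=> /negP; rewrite -leNgt.
- by rewrite ltry => /(_ isT).
Qed.

End EntryTimeEvents.

Section Survival.
Context d {X : measurableType d} {R : realType}.
Variables (mu : probability X R) (T : X -> X) (A : set (set X)) (lambda : R).
Hypothesis GM : gibbs_markov mu T A lambda.
Local Notation P := (fprob mu).
Implicit Types (E F G U : set X).

Let P0 := @fine_probability_ge0 _ _ _ mu.
Let Pca := @countably_additive_probability _ _ _ mu.
Let mpre t E : measurable E -> measurable (iter t T @^-1` E).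
Proof. exact: (measurable_iter_preimage GM). Qed.
Let mpre1 E : measurable E -> measurable (T @^-1` E).
Proof. exact: (mpre 1). Qed.
Let Ple E F : measurable E -> measurable F -> E `<=` F -> P E <= P F.
Proof. exact: countably_additive_le. Qed.
Let Psplit E G : measurable E -> measurable G ->
  P E = P (E `&` G) + P (E `\` G).
Proof. by case: Pca => + _; apply. Qed.

Lemma fprobC E : measurable E -> P (~` E) = 1 - P E.
Proof.
move=> mE; have := Psplit measurableT mE.
by rewrite fine_probabilityT setTI setTD => ->; ring.
Qed.

Lemma measurable_avoid U t : measurable U -> measurable (avoid T U t).
Proof.
move=> mU; elim: t => [|t IH]; first by rewrite avoid0.
by rewrite avoidS; apply: measurableI; [exact: measurableC|exact: mpre1].
Qed.

Lemma avoid_prob_antitone U s t : measurable U -> (s <= t)%N ->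
  P (avoid T U t) <= P (avoid T U s).
Proof. by move=> mU st; apply: Ple; [exact: measurable_avoid..|exact: avoid_le]. Qed.

Lemma hit_prob_le U t : measurable U -> 1 - P (avoid T U t) <= t%:R * P U.
Proof.
move=> mU; elim: t => [|t IH].
  by rewrite avoid0 fine_probabilityT subrr mul0r.
have mUt := mpre t mU; have ma := measurable_avoid t mU.
have : P (avoid T U t `&` iter t T @^-1` U) <= P U.
  rewrite -(probability_iter_preimage GM t mU).
  by apply: Ple => //; exact: measurableI.
rewrite -natr1 mulrDl mul1r; have := Psplit ma mUt; rewrite setDE -avoidSr; lra.
Qed.

(** Decomposition according to the last visit to U: by invariance, a(s) is the
    probability of T^-1 (avoid s), and a(s) - a(s+1) that of starting in U and
    then avoiding U for s steps. *)
Lemma hit_prob_sum U s : measurable U ->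
  1 - P (avoid T U s) = \sum_(i < s) P (tau_gt T U (i%:R : R) `&` U).
Proof.
move=> mU; elim: s => [|s IH].
  by rewrite avoid0 fine_probabilityT subrr big_ord0.
have ma := measurable_avoid s mU.
rewrite big_ord_recr/= -IH tau_gt_nat -(probability_preimage GM ma).
by rewrite (Psplit (mpre1 ma) mU) avoidS setDE [~` U `&` _]setIC; ring.
Qed.

Section Blocks.
Variables (U : set X) (kappa : nat).
Hypothesis mU : measurable U.
Hypothesis dU : determined T A kappa U.
Local Notation a t := (P (avoid T U t)).

Let mav t : measurable (avoid T U t). Proof. exact: measurable_avoid. Qed.
Let dav t : determined T A (t + kappa) (avoid T U t).
Proof. exact: determined_avoid. Qed.

Variables (eps : R) (N : nat).
Hypothesis mixing : mixing_up_to_shift mu T A eps N.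

(** A visit to U in any of the windows [j, j + s), j <= N, is a visit in
    [0, N + s), so the averaged mixing applies to the long window. *)
Lemma survival_block_le t s :
  a (t + kappa + (N + s)) <= a t * (1 - (1 - eps) * (1 - a s)).
Proof.
have mC r : measurable (~` (avoid T U r)) by exact: measurableC.
have [+ _] := mixing (mav t) (@dav t) (mC s) (mC (N + s)%N).
rewrite fprobC// => lo.
have {}lo : (1 - eps) * (a t * (1 - a s)) <=
    P (avoid T U t `&` iter (t + kappa) T @^-1` (~` avoid T U (N + s))).
  apply: lo => j jN x /= nx ax; apply: nx => i il; rewrite -iterD; apply: ax.
  by lia.
have := Psplit (mav t) (mpre (t + kappa) (mav (N + s))).
rewrite setDE preimage_setC => sp.
have : a (t + kappa + (N + s)) <=
    P (avoid T U t `&` iter (t + kappa) T @^-1` avoid T U (N + s)).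
  apply: Ple => //; first by apply: measurableI => //; exact: mpre.
  by rewrite avoidD; apply: setSI; apply: avoid_le; exact: leq_addr.
lra.
Qed.

Variable c : R.
Hypothesis upper : decoupling_bound mu T A c.

(** Avoiding U for t steps is determined by t + kappa symbols, hence the gap. *)
Lemma survival_submultiplicative t s : a (t + kappa + s) <= c * (a t * a s).
Proof.
apply: le_trans (upper (mav t) (@dav t) (mav s)); apply: Ple => //.
  by apply: measurableI => //; exact: mpre.
by rewrite avoidD; apply: setSI; apply: avoid_le; exact: leq_addr.
Qed.

Hypothesis c1 : 1 <= c.

(** The first N steps of the window are treated separately, by the crude bound
    c N mu(U): what remains, a visit in [N, N + s), is a visit in each of the
    windows [j, j + N + s), j <= N. *)
Lemma survival_block_ge t s : a (t + kappa) -
    (c * N%:R * P U + (1 + eps) * (1 - a (N + s))) * a t <=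
  a (t + kappa + (N + s)).
Proof.
have mC r : measurable (~` (avoid T U r)) by exact: measurableC.
have mE' := mpre N (mC s).
have [_ +] := mixing (mav t) (@dav t) (mC (N + s)%N) mE'.
rewrite fprobC// => hi.
have {}hi : P (avoid T U t `&`
      iter (t + kappa) T @^-1` (iter N T @^-1` (~` avoid T U s)))
    <= (1 + eps) * (a t * (1 - a (N + s))).
  apply: hi => j jN x /= nx ax; apply: nx => i il; rewrite -iterD.
  have -> : (i + N = (N - j + i) + j)%N by lia.
  by rewrite iterD; apply: ax; lia.
have up := upper (mav t) (@dav t) (mC N); rewrite fprobC// in up.
have h1 := hit_prob_le N mU.
have ct : 0 <= c * a t by rewrite mulr_ge0 ?P0// (le_trans ler01).
have h2 := ler_wpM2l ct h1.
have mp E := @mpre (t + kappa)%N E.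
set G1 := avoid T U t `&` _ in hi; set G2 := avoid T U t `&` _ in up.
have mG1 : measurable G1 by apply: measurableI => //; exact: mp.
have mG2 : measurable G2 by apply: measurableI => //; exact: mp.
have sp := Psplit (mav (t + kappa)) (mp _ (mav (N + s))).
rewrite -avoidD in sp.
have cov : P (avoid T U (t + kappa) `\`
      iter (t + kappa) T @^-1` avoid T U (N + s))
    <= P G1 + P G2.
  have mU12 : measurable (G1 `|` G2) by exact: measurableU.
  apply: (@le_trans _ _ (P (G1 `|` G2))).
    apply: Ple => //; first by apply: measurableD => //; exact: mp.
    move=> x [axk /= nx]; have ax := avoid_le (leq_addr kappa t) axk.
    have [nx1|ax1] := pselect (avoid T U N (iter (t + kappa) T x)); last by right.
    by left; split=> // ax2; apply: nx; rewrite avoidD.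
  rewrite (Psplit mU12 mG1) lerD//.
    by apply: Ple => //; exact: measurableI.
  by apply: Ple => //; [exact: measurableD|move=> x [[]]].
have e1 : (1 + eps) * (a t * (1 - a (N + s))) = ((1 + eps) * (1 - a (N + s))) * a t.
  by ring.
have e2 : c * a t * (N%:R * P U) = c * N%:R * P U * a t by ring.
have e3 : c * (a t * (1 - a N)) = c * a t * (1 - a N) by ring.
rewrite mulrDl; lra.
Qed.

End Blocks.
End Survival.

(** * Short returns and the existence of escape rates *)

Section PowerSums.
Variable R : realType.

(** Bernoulli's inequality (1 - 1/y)^(1 - p) >= 1 + (p - 1)/y for y = x + 1, by
    way of exp; it bounds the tail of the series of j^-p by telescoping. *)
Lemma powR_telescope (p x : R) : 1 < p -> 0 < x ->
  (p - 1) * (x + 1) `^ (- p) <= x `^ (1 - p) - (x + 1) `^ (1 - p).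
Proof.
move=> p1 x0; have y0 : 0 < x + 1 by rewrite addr_gt0.
have pe (z y : R) : 0 < z -> z `^ y = expR (y * ln z).
  by move=> z0; rewrite /powR gt_eqF.
set y := x + 1 in y0 *.
have y_gt : (y `^ (- p)) = y `^ (1 - p) / y.
  have -> : y^-1 = expR (- ln y) by rewrite expRN lnK.
  by rewrite !pe// -expRD; congr expR; ring.
have lnxy : ln x <= ln y - y^-1.
  have h := expR_ge1Dx (- y^-1).
  have : x <= y * expR (- y^-1).
    apply: le_trans (ler_wpM2l (ltW y0) h).
    by rewrite mulrDr mulr1 mulrN mulfV ?gt_eqF// /y addrK.
  rewrite -ler_ln ?posrE ?mulr_gt0 ?expR_gt0//.
  by rewrite lnM ?posrE ?expR_gt0// expRK.
have : y `^ (1 - p) * (1 + (p - 1) / y) <= x `^ (1 - p).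
  have h := expR_ge1Dx ((p - 1) / y).
  apply: (le_trans (ler_wpM2l (powR_ge0 _ _) h)).
  rewrite !pe// -expRD ler_expR.
  have := ler_wpM2l (ltW (_ : 0 < p - 1)) lnxy; rewrite subr_gt0 => /(_ p1).
  lra.
rewrite y_gt; lra.
Qed.

Lemma powR_sum_tail (p : R) k n : 1 < p -> (0 < k)%N ->
  (p - 1) * (\sum_(i < n) ((k + i).+1)%:R `^ (- p)) <=
  k%:R `^ (1 - p) - (k + n)%:R `^ (1 - p).
Proof.
move=> p1 k0; elim: n => [|n IH]; first by rewrite big_ord0 mulr0 addn0 subrr.
have kn0 : 0 < (k + n)%:R :> R by rewrite ltr0n addn_gt0 k0.
have := powR_telescope p1 kn0; rewrite natr1.
by rewrite big_ord_recr/= mulrDr addnS; lra.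
Qed.

End PowerSums.

Section ShortReturns.
Context d {X : measurableType d} {R : realType}.
Variables (mu : probability X R) (T : X -> X) (A : set (set X)) (lambda : R).
Hypothesis GM : gibbs_markov mu T A lambda.
Local Notation P := (fprob mu).

Let P0 := @fine_probability_ge0 _ _ _ mu.
Let mpre t E : measurable E -> measurable (iter t T @^-1` E).
Proof. exact: (measurable_iter_preimage GM). Qed.
Let Ple E F : measurable E -> measurable F -> E `<=` F -> P E <= P F.
Proof.
exact/countably_additive_le/fine_probability_ge0/countably_additive_probability.
Qed.

(** A return at time j has conditional probability at most
    c (mu(U) + C j^-p): for j >= kappa by mixing, as U is a union of j-cylinders,
    and for j < kappa by mixing for the larger set approx U j. *)
Lemma short_returns (U : set X) (kappa : nat) (c C p : R) k n :
  union_of (cylinders T A kappa) U -> 1 <= c ->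
  decoupling_bound mu T A c ->
  0 < C -> 1 < p ->
  (forall j, (0 < j < kappa)%N ->
     (mu (Defs.approx T A U j) <= mu U + (C * j%:R `^ (- p))%:E)%E) ->
  (0 < k)%N ->
  P (tau_gt T U (k%:R : R) `&` U) - P (tau_gt T U ((k + n)%:R : R) `&` U) <=
  c * P U * (n%:R * P U + C / (p - 1) * k%:R `^ (1 - p)).
Proof.
move=> uU c1 upper C0 p1 appr k0.
have mU := measurable_union_of GM uU.
have dU : determined T A kappa U := determined_union_of (gm_trivIset GM) uU.
have c0 : 0 < c by apply: lt_le_trans c1.
have ret j : (0 < j)%N ->
    P (U `&` iter j T @^-1` U) <= c * P U * (P U + C * j%:R `^ (- p)).
  move=> j0; have Cj : 0 <= C * j%:R `^ (- p) by rewrite mulr_ge0 ?powR_ge0// ltW.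
  have [jk|kj] := ltnP j kappa; last first.
    apply: (le_trans (upper _ _ _ mU (determined_le kj dU) mU)).
    by rewrite mulrA ler_wpM2l ?lerDl// mulr_ge0 ?P0// ltW.
  have uA : union_of (cylinders T A j) (Defs.approx T A U j).
    by exists [set B | cylinders T A j B /\ B `&` U !=set0] => // B [].
  have mA := measurable_union_of GM uA.
  have dA := determined_union_of (gm_trivIset GM) uA.
  have UA : U `<=` Defs.approx T A U j.
    move=> x Ux; have [B [cB Bx _]] : same_cylinder T A j x x.
      apply/same_cylinderP => i _; have [b Ab bx] := gm_cover GM (iter i T x).
      by exists b.
    by exists B => //; split=> //; exists x.
  have PA : P (Defs.approx T A U j) <= P U + C * j%:R `^ (- p).
    by rewrite -lee_fin EFinD !probability_fineK//; apply: appr; rewrite j0.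
  apply: (@le_trans _ _ (P (Defs.approx T A U j `&` iter j T @^-1` U))).
    apply: Ple; [|by apply: measurableI => //; exact: mpre|exact: setSI].
    by apply: measurableI => //; exact: mpre.
  apply: (le_trans (upper _ _ _ mA dA mU)).
  by rewrite [_ * P U]mulrC mulrA ler_wpM2l// mulr_ge0 ?P0// ltW.
have mav t : measurable (avoid T U t) := measurable_avoid GM t mU.
have step t : P (tau_gt T U (t%:R : R) `&` U) -
    P (tau_gt T U (t.+1%:R : R) `&` U) <= P (U `&` iter t.+1 T @^-1` U).
  rewrite !tau_gt_nat lerBlDr.
  have mt : measurable (T @^-1` avoid T U t `&` U).
    by apply: measurableI => //; exact: (mpre 1).
  have [add _] := countably_additive_probability mu.
  rewrite (add _ (iter t.+1 T @^-1` U) mt (mpre _ mU)) lerD//.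
    apply: Ple; [by apply: measurableI => //; exact: mpre| |].
      by apply: measurableI => //; exact: mpre.
    by move=> x [[]].
  apply: Ple; [by apply: measurableD => //; exact: mpre| |].
    by apply: measurableI => //; exact: (mpre 1).
  move=> x [[ax Ux] nx]; split=> //; rewrite /preimage/= avoidSr; split=> //.
  by move=> /= bx; apply: nx; rewrite /preimage/= -iterS iterSr.
have p0 : 0 < p - 1 by rewrite subr_gt0.
have tail := powR_sum_tail n p1 k0.
have sumb : P (tau_gt T U (k%:R : R) `&` U) - P (tau_gt T U ((k + n)%:R : R) `&` U)
   <= c * P U * (n%:R * P U + C * (\sum_(i < n) ((k + i).+1)%:R `^ (- p))).
  elim: n {tail} => [|n IH].
    by rewrite addn0 subrr mul0r big_ord0 mulr0 addr0 mulr0.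
  rewrite big_ord_recr/= addnS.
  have := le_trans (step (k + n)%N) (ret _ (ltn0Sn _)).
  set z := _ `^ _; set s := \sum_(i < n) _ in IH *.
  have -> : c * P U * (n.+1%:R * P U + C * (s + z)) =
      c * P U * (n%:R * P U + C * s) + c * P U * (P U + C * z).
    by rewrite -natr1; ring.
  lra.
apply: (le_trans sumb); rewrite ler_wpM2l ?mulr_ge0 ?P0 ?(ltW c0)// lerD2l.
rewrite -mulrA ler_wpM2l ?(ltW C0)// -ler_pdivrMl ?invr_gt0// invrK.
apply: (le_trans tail); rewrite gerBl; exact: powR_ge0.
Qed.

End ShortReturns.

Section EscapeLimit.
Variable R : realType.
Local Open Scope ereal_scope.

(** Fekete's lemma for - ln a(t), which is superadditive up to the constant ln c
    and the gap kappa.  The limit is the supremum S of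
    (- ln a(j) - ln c) / (j + kappa + 1), which may be infinite; the rate is also
    infinite when a vanishes from some time on. *)
Lemma fekete_cvg (a : nat -> R) (kappa : nat) (c : R) :
  (forall t, (0 <= a t <= 1)%R) -> (forall s t, (s <= t)%N -> (a t <= a s)%R) ->
  (1 <= c)%R ->
  (forall t s, (a (t + kappa + s)%N <= c * (a t * a s))%R) ->
  cvg ((fun t : R => t^-1%:E * `|lne (a (Num.truncn t))%:E|) t @[t --> +oo%R]).
Proof.
move=> a01 anti c1 sub; apply/cvg_ex.
have [[m am]|pos] := pselect (exists m, (a m <= 0)%R).
  exists +oo; apply: cvg_near_cst; near=> t.
  have t0 : (0 < t)%R by near: t; exact: nbhs_pinfty_gt.
  rewrite le0_lneNy; last first.
    rewrite lee_fin; apply: le_trans am; apply: anti.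
    by rewrite truncn_ge_nat ?(ltW t0)//; near: t; exact: nbhs_pinfty_ge.
  by rewrite /= mulry gtr0_sg ?invr_gt0// mul1e.
have {}pos m : (0 < a m)%R by rewrite ltNge; apply/negP => am; apply: pos; exists m.
pose w m : R := (- ln (a m))%R; pose l : R := ln c; pose k := kappa.+1.
have l0 : (0 <= l)%R by exact: ln_ge0.
have w0 m : (0 <= w m)%R by rewrite oppr_ge0 ln_le0//; case/andP: (a01 m).
have wmono s t : (s <= t)%N -> (w s <= w t)%R.
  by move=> st; rewrite lerN2 ler_ln ?posrE//; exact: anti.
have wsup t s : (w t + w s - l <= w (t + k + s)%N)%R.
  apply: (@le_trans _ _ (w (t + kappa + s)%N)); last first.
    by apply: wmono; rewrite /k; lia.
  have := sub t s; rewrite -ler_ln ?posrE ?mulr_gt0//; last by apply: lt_le_trans c1.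
  rewrite !lnM ?posrE ?mulr_gt0//; last by apply: lt_le_trans c1.
  by rewrite /w /l; lra.
have wq j q : (q%:R * (w j - l) <= w (q * (j + k))%N)%R.
  elim: q => [|q IH]; first by rewrite mul0r w0.
  have := wsup j (q * (j + k))%N; rewrite -mulSn -natr1 mulrDl mul1r; lra.
pose f (t : R) : R := (t^-1 * w (Num.truncn t))%R.
have -> : (fun t : R => t^-1%:E * `|lne (a (Num.truncn t))%:E|) = EFin \o f.
  apply/funext => t; rewrite lne_EFin// [RHS]/= /f EFinM; congr (_ * _%:E).
  by rewrite /w -normrN ger0_norm// w0.
have f0 t : (0 <= t)%R -> (0 <= f t)%R by move=> t0; rewrite mulr_ge0 ?invr_ge0.
have lb j eps : (0 < eps)%R ->
    \forall t \near +oo%R, ((w j - l) / (j + k)%:R - eps <= f t)%R.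
  move=> eps0; have p0 : (0 < (j + k)%:R :> R)%R by rewrite ltr0n addnS.
  have [b0|b0] := leP (w j - l)%R 0%R.
    near=> t; apply: (@le_trans _ _ 0%R).
      rewrite subr_le0 (le_trans _ (ltW eps0))//.
      by rewrite pmulr_lle0// invr_gt0.
    by apply: f0; near: t; exact: nbhs_pinfty_ge.
  near=> t.
  have t0 : (0 < t)%R by near: t; exact: nbhs_pinfty_gt.
  have tbig : ((w j - l) * (1 + (j + k)%:R) / ((j + k)%:R * eps) <= t)%R.
    by near: t; apply: nbhs_pinfty_ge; rewrite num_real.
  have /andP[_ tm] := truncn_itv (ltW t0).
  set m := Num.truncn t in tm; set p := (j + k)%N in p0 tbig *.
  have mq : (m%:R < (m %/ p)%:R * p%:R + p%:R :> R)%R.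
    rewrite -natrM -natrD ltr_nat {1}(divn_eq m p) ltn_add2l ltn_pmod//.
    by rewrite -(ltr_nat R).
  have wm : ((m %/ p)%:R * (w j - l) <= w m)%R.
    by apply: (le_trans (wq j _)); apply: wmono; exact: leq_trunc_div.
  rewrite /f -/m -ler_pdivrMl ?invr_gt0// invrK.
  apply: le_trans wm.
  rewrite -(ler_pM2r p0).
  have e1 : ((m %/ p)%:R * (w j - l) * p%:R =
     (w j - l) * ((m %/ p)%:R * p%:R))%R by ring.
  have e2 : (t * ((w j - l) / p%:R - eps) * p%:R =
     (w j - l) * t - t * (p%:R * eps))%R by field; rewrite gt_eqF.
  rewrite e1 e2.
  have h1 : ((w j - l) * (1 + p%:R) <= t * (p%:R * eps))%R.
    by rewrite -ler_pdivrMr// mulr_gt0.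
  have h2 : ((w j - l) * (t - 1 - p%:R) <= (w j - l) * ((m %/ p)%:R * p%:R))%R.
    by rewrite ler_wpM2l ?(ltW b0)//; move: tm; rewrite -natr1; lra.
  lra.
pose S := [set x : R | x = 0%R \/ exists j, x = ((w j - l) / (j + k)%:R)%R].
have lbS x eps : S x -> (0 < eps)%R -> \forall t \near +oo%R, (x - eps <= f t)%R.
  move=> [->|[j ->]] eps0; last exact: lb.
  near=> t; have t0 : (0 <= t)%R by near: t; exact: nbhs_pinfty_ge.
  by apply: le_trans (f0 t t0); rewrite sub0r oppr_le0 ltW.
have S0 : S 0%R by left.
have [hS|nS] := pselect (has_sup S); last first.
  exists +oo; apply/cvgeryP/cvgryPge => B.
  have [x Sx Bx] : exists2 x, S x & (B + 1 < x)%R.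
    apply: contrapT => nx; apply: nS; split; first by exists 0%R.
    exists (B + 1)%R => x Sx; rewrite leNgt; apply/negP => Bx; apply: nx.
    by exists x.
  near=> t; have : (x - 1 <= f t)%R by near: t; exact: lbS.
  lra.
exists (sup S)%:E; apply: cvg_EFin; first by near=> t.
apply/cvgrPdist_le => /= eps eps0.
have s0 : (0 <= sup S)%R by apply: ub_le_sup => //; case: hS.
have e20 : (0 < eps / 2)%R by rewrite divr_gt0.
have [x Sx xs] := sup_adherent e20 hS.
near=> t; rewrite ler_distl.
have t0 : (0 < t)%R by near: t; exact: nbhs_pinfty_gt.
have tbig : ((sup S * k%:R + l) / eps <= t)%R.
  by near: t; apply: nbhs_pinfty_ge; rewrite num_real.
have lbt : (x - eps / 2 <= f t)%R by near: t; exact: lbS.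
have /andP[mt _] := truncn_itv (ltW t0).
have up : (w (Num.truncn t) <= sup S * (t + k%:R) + l)%R.
  set m := Num.truncn t in mt *.
  have : ((w m - l) / (m + k)%:R <= sup S)%R.
    by apply: ub_le_sup; [case: hS|right; exists m].
  have mk0 : (0 < (m + k)%:R :> R)%R by rewrite ltr0n addnS.
  rewrite ler_pdivrMr// natrD => h.
  have := ler_wpM2l s0 mt; lra.
apply/andP; split; last by lra.
rewrite lerBlDr /f -ler_pdivlMl ?invr_gt0// invrK.
apply: (le_trans up); rewrite ler_pdivrMr// in tbig; lra.
Unshelve. all: by end_near. Qed.

Lemma escape_along_multiples (f : R -> \bar R) (rho : \bar R) (p : nat) :
  (0 < p)%N -> f t @[t --> +oo%R] --> rho ->
  f ((n * p)%:R)%R @[n --> \oo] --> rho.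
Proof.
move=> p0; apply: cvg_comp.
apply/cvgryPge => B; near=> n.
apply: (@le_trans _ _ n%:R); first by near: n; exact: nbhs_infty_ger.
by rewrite ler_nat leq_pmulr.
Unshelve. all: by end_near. Qed.

End EscapeLimit.

(** * Escape rates by blocks *)

(** With r = (1 - 3 eta) / (1 - 2 eta) one has eta <= r (1 - r) for
    eta <= 1/4, and this is what the induction on r a(k s) <= a((k + 1) s)
    needs.  The exponent comes from r = 1 / (1 + eta / (1 - 3 eta)). *)
Lemma geometric_lower_bound (R : realType) (a : nat -> R) (s : nat) (eta : R) :
  0 <= eta <= 1 / 4 -> a 0%N = 1 -> 1 - eta <= a s ->
  (forall k, a (k.+1 * s)%N - eta * a (k * s)%N <= a (k.+2 * s)%N) ->
  forall k, expR (- (k%:R * (eta / (1 - 3 * eta)))) <= a (k * s)%N.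
Proof.
move=> /andP[e0 e4] a0 as_ rec k.
have e3 : 0 < 1 - 3 * eta by lra.
have e2 : 0 < 1 - 2 * eta by lra.
pose r := (1 - 3 * eta) / (1 - 2 * eta).
have r0 : 0 < r by rewrite divr_gt0.
have r1 : r <= 1 by rewrite ler_pdivrMr//; lra.
have re : eta <= r * (1 - r).
  rewrite -(ler_pM2r (mulr_gt0 e2 e2)).
  have -> : r * (1 - r) * ((1 - 2 * eta) * (1 - 2 * eta)) = (1 - 3 * eta) * eta.
    by rewrite /r; field; rewrite gt_eqF.
  by nra.
have : r ^+ k <= a (k * s)%N /\ r * a (k * s)%N <= a (k.+1 * s)%N.
  elim: k => [|k [IH1 IH2]].
    rewrite mul0n mul1n a0 expr0 mulr1; split=> //; apply: le_trans as_; nra.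
  have IH3 : r ^+ k.+1 <= a (k.+1 * s)%N.
    by apply: le_trans IH2; rewrite exprS ler_wpM2l// ltW.
  split=> //; have ak0 : 0 <= a (k * s)%N.
    by apply: le_trans IH1; rewrite exprn_ge0// ltW.
  have h1 := ler_wpM2r ak0 re.
  have h2 : 0 <= 1 - r by lra.
  have := ler_wpM2l h2 IH2; have := rec k; lra.
case=> + _; apply: le_trans.
rewrite -mulrN expRM_natl lerXn2r ?nnegrE ?expR_ge0 ?(ltW r0)//.
have -> : r = (1 + eta / (1 - 3 * eta))^-1.
  by rewrite /r; field; rewrite !gt_eqF//; lra.
have b0 : 0 <= eta / (1 - 3 * eta) by rewrite divr_ge0// ltW.
rewrite expRN lef_pV2 ?posrE ?expR_gt0 ?expR_ge1Dx//; lra.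
Qed.

Section EscapeRateBounds.
Context d {X : measurableType d} {R : realType}.
Variables (mu : probability X R) (T : X -> X) (A : set (set X)) (lambda : R).
Hypothesis GM : gibbs_markov mu T A lambda.
Local Notation P := (fprob mu).

Lemma fprob_avoid01 U t : measurable U -> 0 <= P (avoid T U t) <= 1.
Proof.
move=> mU; apply/andP; split.
  by apply: fine_probability_ge0; exact: (measurable_avoid GM).
have := avoid_prob_antitone GM mU (leq0n t).
by rewrite avoid0 fine_probabilityT.
Qed.

Lemma log_survival_rateE U (t : R) : measurable U -> 0 <= t ->
  log_survival_rate mu T U t =
  (t^-1%:E * `|lne (P (avoid T U (Num.truncn t)))%:E|)%E.
Proof.
move=> mU t0; rewrite /log_survival_rate tau_gt_avoid//.
have ma := measurable_avoid GM (Num.truncn t) mU.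
rewrite -(probability_preimage GM ma) probability_fineK//.
exact: (measurable_preimage (gm_measurableT GM)).
Qed.

Variables (U : set X) (kappa : nat) (c : R).
Hypothesis mU : measurable U.
Hypothesis dU : determined T A kappa U.
Hypothesis c1 : 1 <= c.
Hypothesis upper : decoupling_bound mu T A c.

Lemma log_survival_rate_cvg : cvg (log_survival_rate mu T U t @[t --> +oo]).
Proof.
have := @fekete_cvg R (fun t => P (avoid T U t)) kappa c.
move=> /(_ (fun t => fprob_avoid01 t mU)).
move=> /(_ (fun s t => avoid_prob_antitone GM mU (s := s) (t := t)) c1).
move=> /(_ (survival_submultiplicative GM mU dU upper)) /cvg_ex[l ul].
apply/cvg_ex; exists l; apply: cvg_trans ul; apply: near_eq_cvg; near=> t.
rewrite log_survival_rateE//; near: t; exact: nbhs_pinfty_ge.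
Unshelve. all: by end_near. Qed.

Lemma escape_rate_ge (b : R) p : (0 < p)%N ->
  (forall k, P (avoid T U (k * p)) <= expR (- (k%:R * b))) ->
  ((b / p%:R)%:E <= escape_rate mu T U)%E.
Proof.
move=> p0 ab; have cv := escape_along_multiples p0 log_survival_rate_cvg.
rewrite /escape_rate -(cvg_lim _ cv)//; apply: lime_ge.
  by apply/cvg_ex; eexists; exact: cv.
near=> k; have k0 : (0 < k)%N by near: k; exact: nbhs_infty_gt.
rewrite log_survival_rateE// natrK.
have kp0 : 0 < (k * p)%:R :> R by rewrite ltr0n muln_gt0 k0.
have [x0|x0] := leP (P (avoid T U (k * p))) 0.
  by rewrite le0_lneNy// mulry gtr0_sg ?invr_gt0// mul1e leey.
rewrite lne_EFin//= -EFinM lee_fin.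
have lx : ln (P (avoid T U (k * p))) <= - (k%:R * b).
  by rewrite -(expRK (- (k%:R * b))) ler_ln ?posrE ?expR_gt0//; exact: ab.
rewrite [leRHS]mulrC ler_pdivlMr// natrM.
rewrite (_ : b / p%:R * (k%:R * p%:R) = k%:R * b); last first.
  by field; rewrite pnatr_eq0 -lt0n.
apply: le_trans (_ : - ln (P (avoid T U (k * p))) <= _); first by lra.
by rewrite -normrN ler_norm.
Unshelve. all: by end_near. Qed.

Lemma escape_rate_le (b : R) p : (0 < p)%N ->
  (forall k, expR (- (k%:R * b)) <= P (avoid T U (k * p))) ->
  (escape_rate mu T U <= (b / p%:R)%:E)%E.
Proof.
move=> p0 ab; have cv := escape_along_multiples p0 log_survival_rate_cvg.
rewrite /escape_rate -(cvg_lim _ cv)//; apply: lime_le.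
  by apply/cvg_ex; eexists; exact: cv.
near=> k; have k0 : (0 < k)%N by near: k; exact: nbhs_infty_gt.
rewrite log_survival_rateE// natrK.
have kp0 : 0 < (k * p)%:R :> R by rewrite ltr0n muln_gt0 k0.
have x0 : 0 < P (avoid T U (k * p)) by exact: lt_le_trans (expR_gt0 _) (ab k).
rewrite lne_EFin//= -EFinM lee_fin.
have lx : - (k%:R * b) <= ln (P (avoid T U (k * p))).
  by rewrite -[leLHS]expRK ler_ln ?posrE ?expR_gt0//; exact: ab.
rewrite [leLHS]mulrC ler_pdivrMr// natrM.
rewrite (_ : b / p%:R * (k%:R * p%:R) = k%:R * b); last first.
  by field; rewrite pnatr_eq0 -lt0n.
have /andP[_ x1] := fprob_avoid01 (k * p) mU.
by rewrite ler0_norm ?ln_le0//; lra.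
Unshelve. all: by end_near. Qed.

Variables (eps : R) (N : nat).
Hypothesis mixing : mixing_up_to_shift mu T A eps N.

Lemma escape_rate_block_ge s : (0 < kappa + (N + s))%N ->
  (((1 - eps) * (1 - P (avoid T U s)) / (kappa + (N + s))%:R)%:E
    <= escape_rate mu T U)%E.
Proof.
move=> p0; apply: escape_rate_ge => // k.
elim: k => [|k IH]; first by rewrite mul0n mul0r oppr0 expR0 avoid0 fine_probabilityT.
have /andP[a0 _] := fprob_avoid01 (k * (kappa + (N + s))) mU.
rewrite mulSn [(_ + k * _)%N]addnC [(k * _ + _)%N]addnA.
apply: (le_trans (survival_block_le GM mU dU mixing _ s)).
set y := (1 - eps) * _.
have -> : - (k.+1%:R * y) = - (k%:R * y) + - y by rewrite -natr1; ring.
rewrite expRD; apply: (le_trans (ler_wpM2l a0 (expR_ge1Dx (- y)))).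
by rewrite ler_wpM2r ?expR_ge0.
Qed.

(** The gap kappa is absorbed by going back one block: as kappa <= s, the
    recursion involves the survival probabilities at three consecutive multiples
    of s, which is the form required by [geometric_lower_bound]. *)
Lemma escape_rate_block_le s (eta : R) : 0 <= eps ->
  eta = c * N%:R * P U + (1 + eps) * (1 - P (avoid T U s)) ->
  eta <= 1 / 4 -> (N <= s)%N -> (kappa <= s)%N -> (0 < s)%N ->
  (escape_rate mu T U <= (eta / (1 - 3 * eta) / s%:R)%:E)%E.
Proof.
move=> eps0 etaE eta4 Ns ks s0; apply: escape_rate_le => // k.
have /andP[_ as1] := fprob_avoid01 s mU.
have u0 : 0 <= P U by exact: fine_probability_ge0.
have cu0 : 0 <= c * N%:R * P U by rewrite !mulr_ge0// (le_trans ler01).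
have eh0 : 0 <= eps * (1 - P (avoid T U s)) by rewrite mulr_ge0// subr_ge0.
apply: (@geometric_lower_bound R (fun t => P (avoid T U t))) => [||| {}k].
- by rewrite eta4 andbT etaE; lra.
- by rewrite avoid0 fine_probabilityT.
- by rewrite etaE; lra.
have kk : (kappa <= k.+1 * s)%N by rewrite (leq_trans ks)// leq_pmull.
have := survival_block_ge GM mU dU mixing upper c1 (k.+1 * s - kappa)%N (s - N)%N.
rewrite subnK// subnKC// -mulSnr -etaE => /(le_trans _); apply.
rewrite lerD2l lerN2 ler_wpM2l//; first by rewrite etaE; lra.
by apply: (avoid_prob_antitone GM mU); rewrite mulSn; lia.
Qed.

End EscapeRateBounds.

Section Asymptotics.
Variable R : realType.

Lemma powR_small (e delta : R) : 0 < e -> 0 < delta ->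
  exists2 z : R, 0 < z & forall u, 0 <= u <= z -> u `^ e <= delta.
Proof.
move=> e0 d0; exists (delta `^ e^-1); first exact: powR_gt0.
move=> u /andP[u0 uz].
have -> : delta = (delta `^ e^-1) `^ e by rewrite -powRrM mulVf ?gt_eqF// powRr1// ltW.
by rewrite ge0_ler_powR ?nnegrE ?powR_ge0// ltW.
Qed.

(** The witness is s = floor (u^-e): s u is at most u^(1-e), and kappa / s
    is of the order of kappa u^e. *)
Lemma block_length (u : nat -> R) (kappa : nat -> nat) (e : R) :
  (forall n, 0 < u n) -> u n @[n --> \oo] --> 0 -> 0 < e < 1 ->
  (kappa n)%:R * u n `^ e @[n --> \oo] --> 0 ->
  exists s : nat -> nat, forall delta : R, 0 < delta -> \forall n \near \oo,
    [/\ (s n)%:R * u n <= delta, 1 <= delta * (s n)%:R &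
        (kappa n)%:R <= delta * (s n)%:R].
Proof.
move=> u0 ucv /andP[e0 e1] kcv; exists (fun n => Num.truncn (u n `^ e)^-1).
move=> delta d0.
have d20 : 0 < Num.min (delta / 2) (2^-1) :> R by rewrite lt_min divr_gt0//=.
have e10 : 0 < 1 - e by rewrite subr_gt0.
have [z1 z10 z1P] := powR_small e0 d20.
have [z2 z20 z2P] := powR_small e10 d0.
near=> n; have un := u0 n.
have absu : `|0 - u n| = u n by rewrite sub0r normrN gtr0_norm.
have uz1 : u n <= z1.
  by rewrite -absu; near: n; move/cvgrPdist_le : ucv; exact.
have uz2 : u n <= z2.
  by rewrite -absu; near: n; move/cvgrPdist_le : ucv; exact.
have kz : (kappa n)%:R * u n `^ e <= delta / 2.
  have : `|0 - (kappa n)%:R * u n `^ e| <= delta / 2.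
    by near: n; move/cvgrPdist_le : kcv; apply; rewrite divr_gt0.
  by rewrite sub0r normrN ger0_norm// mulr_ge0// powR_ge0.
have z0 : 0 < u n `^ e by exact: powR_gt0.
have := z1P (u n); rewrite (ltW un) uz1 => /(_ isT); rewrite le_min => /andP[zd z2'].
have := z2P (u n); rewrite (ltW un) uz2 => /(_ isT) ud.
set z := u n `^ e in z0 zd z2' kz *.
have uE : u n `^ (1 - e) = u n / z.
  rewrite powRB ?gt_eqF ?implybT// powRr1 ?(ltW un)//.
have zi : 0 < z^-1 by rewrite invr_gt0.
have /andP[s1 s2] := truncn_itv (ltW zi); set s := Num.truncn _ in s1 s2 *.
have szz : 1 <= 2 * z * s%:R.
  have h : z * z^-1 = 1 by rewrite mulfV// gt_eqF.
  have h2 : z * z^-1 < z * s.+1%:R by rewrite ltr_pM2l.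
  by rewrite h -natr1 in h2; lra.
have sn0 : 0 <= s%:R :> R by [].
split.
- by apply: le_trans ud; rewrite uE mulrC ler_wpM2l// ltW.
- by apply: (le_trans szz); rewrite ler_wpM2r//; lra.
rewrite -(ler_pM2r z0); apply: (le_trans kz).
have := ler_wpM2l (ltW d0) szz; lra.
Unshelve. all: by end_near. Qed.

End Asymptotics.

(** * Averages of conditional survival probabilities *)

Lemma powR_neg_small (R : realType) (r delta : R) : 0 < r -> 0 < delta ->
  \forall k \near \oo, k%:R `^ (- r) <= delta.
Proof.
move=> r0 d0; have [z z0 zP] := powR_small r0 d0.
near=> k; have kz : z^-1 <= k%:R by near: k; exact: nbhs_infty_ger.
have k0 : 0 < k%:R :> R by apply: lt_le_trans kz; rewrite invr_gt0.
have -> : k%:R `^ (- r) = (k%:R^-1 : R) `^ r.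
  by rewrite -powR_inv1 ?(ltW k0)// -powRrM mulN1r.
by rewrite zP// invr_ge0 ltW//= -[leRHS]invrK lef_pV2 ?posrE ?invr_gt0.
Unshelve. all: by end_near. Qed.

(** The average of a non-increasing sequence over [0, s) lies between its value
    at s and k / s plus its value at k; the two values differ little for k
    fixed and large. *)
Lemma average_survival_cvg (R : realType) (x : nat -> nat -> R)
    (alpha : nat -> R) (alpha1 c D r : R) (u : nat -> R) (s : nat -> nat) :
  (forall n i, 0 <= x n i <= 1) ->
  (forall n i j, (i <= j)%N -> x n j <= x n i) ->
  (\forall k \near \oo, x n k @[n --> \oo] --> alpha k) ->
  alpha k @[k --> \oo] --> alpha1 ->
  0 <= c -> 0 <= D -> 0 < r -> (forall n, 0 <= u n) ->
  (forall n k m, (0 < k)%N ->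
     x n k - x n (k + m)%N <= c * (m%:R * u n + D * k%:R `^ (- r))) ->
  (forall delta : R, 0 < delta -> \forall n \near \oo,
     (s n)%:R * u n <= delta /\ 1 <= delta * (s n)%:R) ->
  forall eps : R, 0 < eps -> \forall n \near \oo,
    alpha1 - eps <= (\sum_(i < s n) x n i) / (s n)%:R <= alpha1 + eps.
Proof.
move=> x01 xanti xcv acv c0 D0 r0 u0 clus sP eps eps0.
have e4 : 0 < eps / 4 by rewrite divr_gt0.
have cD0 : 0 < c * D + 1 by rewrite ltr_wpDl// mulr_ge0.
have c10 : 0 < c + 1 by rewrite ltr_wpDl.
have dD0 : 0 < eps / 4 / (c * D + 1) by rewrite divr_gt0.
have dc0 : 0 < eps / 4 / (c + 1) by rewrite divr_gt0.
have [k [k0 kcv ka kpow]] : exists k, [/\ (0 < k)%N,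
    x n k @[n --> \oo] --> alpha k, `|alpha1 - alpha k| <= eps / 4 &
    k%:R `^ (- r) <= eps / 4 / (c * D + 1)].
  have near_k : \forall k \near \oo, [/\ (0 < k)%N,
    x n k @[n --> \oo] --> alpha k, `|alpha1 - alpha k| <= eps / 4 &
    k%:R `^ (- r) <= eps / 4 / (c * D + 1)].
    near=> k; split.
    - by near: k; exact: nbhs_infty_gt.
    - by near: k.
    - by near: k; move/cvgrPdist_le : acv; exact.
    - by near: k; exact: powR_neg_small.
  by have [k _ /(_ k (leqnn k))] := near_k; exists k.
have k10 : 0 < k%:R + 1 :> R by rewrite ltr_wpDl.
have dk0 : 0 < eps / 4 / (k%:R + 1) by rewrite divr_gt0.
pose dk : R := (k%:R + 1)^-1; have ki0 : 0 < dk by rewrite invr_gt0.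
near=> n.
have xa : `|alpha k - x n k| <= eps / 4.
  by near: n; move/cvgrPdist_le : kcv; exact.
have [su _] : (s n)%:R * u n <= eps / 4 / (c + 1) /\
    1 <= eps / 4 / (c + 1) * (s n)%:R by near: n; exact: sP.
have [_ sk] : (s n)%:R * u n <= eps / 4 / (k%:R + 1) /\
    1 <= eps / 4 / (k%:R + 1) * (s n)%:R by near: n; exact: sP.
have [_ s1'] : (s n)%:R * u n <= dk /\ 1 <= dk * (s n)%:R.
  by near: n; exact: (sP dk ki0).
have s1 : k%:R <= (s n)%:R :> R.
  by move: s1'; rewrite /dk mulrC ler_pdivlMr// mul1r; lra.
have s0 : 0 < (s n)%:R :> R by apply: lt_le_trans s1; rewrite ltr0n.
have [m sE] : exists m, s n = (k + m)%N.
  by exists (s n - k)%N; rewrite subnKC// -(ler_nat R).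
have sum_le : \sum_(i < s n) x n i <= k%:R + (s n)%:R * x n k.
  rewrite sE big_split_ord/= natrD mulrDl; apply: lerD.
    rewrite (_ : k%:R = \sum_(i < k) 1); last by rewrite sumr_const card_ord.
    by apply: ler_sum => i _; case/andP: (x01 n i).
  apply: (@le_trans _ _ (m%:R * x n k)).
    rewrite (_ : m%:R * x n k = \sum_(i < m) x n k); last first.
      by rewrite sumr_const card_ord mulr_natl.
    by apply: ler_sum => i _; apply: xanti; exact: leq_addr.
  by rewrite lerDr mulr_ge0//; case/andP: (x01 n k).
have sum_ge : (s n)%:R * x n (s n) <= \sum_(i < s n) x n i.
  rewrite (_ : (s n)%:R * _ = \sum_(i < s n) x n (s n)); last first.
    by rewrite sumr_const card_ord mulr_natl.
  by apply: ler_sum => i _; apply: xanti; exact: ltnW.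
have skn : k%:R <= eps / 4 * (s n)%:R.
  move: sk; rewrite mulrAC ler_pdivlMr// mul1r; lra.
have tail : x n k - x n (s n) <= eps / 2.
  rewrite sE; apply: (le_trans (clus n k m k0)).
  have h1 : c * (m%:R * u n) <= eps / 4.
    apply: (@le_trans _ _ (c * (eps / 4 / (c + 1)))).
      rewrite ler_wpM2l// (le_trans _ su)// ler_wpM2r ?u0//.
      by rewrite ler_nat sE leq_addl.
    by rewrite mulrA ler_pdivrMr// mulrC; nra.
  have h2 : c * (D * k%:R `^ (- r)) <= eps / 4.
    rewrite mulrA; apply: (@le_trans _ _ (c * D * (eps / 4 / (c * D + 1)))).
      by rewrite ler_wpM2l// mulr_ge0.
    by rewrite mulrA ler_pdivrMr// mulrC; nra.
  rewrite mulrDr; lra.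
move: xa ka; rewrite !ler_norml => /andP[xa1 xa2] /andP[ka1 ka2].
rewrite ler_pdivlMr// ler_pdivrMr//; apply/andP; split.
  apply: le_trans sum_ge; rewrite mulrC ler_wpM2l ?(ltW s0)//; lra.
apply: (le_trans sum_le); apply: (le_trans (lerD skn (lexx _))).
rewrite [(s n)%:R * _]mulrC -mulrDl ler_wpM2r ?(ltW s0)//; lra.
Unshelve. all: by end_near. Qed.

Lemma nonincreasing_eventually_cvg (R : realType) (a : nat -> R) (k0 : nat) :
  (forall k, (k0 <= k)%N -> 0 <= a k) ->
  (forall i j, (k0 <= i <= j)%N -> a j <= a i) ->
  exists l : R, a k @[k --> \oo] --> l.
Proof.
move=> a0 anti; have /cvg_ex[l al] : cvgn (fun k => a (k + k0)%N).
  apply: nonincreasing_is_cvgn.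
    by move=> i j ij; apply: anti; rewrite leq_addl leq_add2r.
  by exists 0 => _ [k _ <-]; apply: a0; exact: leq_addl.
by exists l; rewrite -(cvg_shiftn k0).
Qed.

Section LocalizedEscapeRate.
Context d {X : measurableType d} {R : realType}.
Variables (mu : probability X R) (T : X -> X) (A : set (set X)) (lambda : R).
Hypothesis GM : gibbs_markov mu T A lambda.
Local Notation P := (fprob mu).

Lemma cond_probE U E : cond_prob mu U E = P (E `&` U) / P U.
Proof. by []. Qed.

Lemma hat_alpha2E U k : measurable U -> 0 < P U ->
  hat_alpha_in mu T 2 k U = 1 - cond_prob mu U (tau_gt T U (k%:R : R)).
Proof.
move=> mU u0; rewrite /hat_alpha_in /= tau_iter_le1 !cond_probE.
have mt : measurable (tau_gt T U (k%:R : R)).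
  rewrite tau_gt_nat; apply: (measurable_preimage (gm_measurableT GM)).
  exact: (measurable_avoid GM).
have [add _] := countably_additive_probability mu.
have := add _ _ mU mt; rewrite setDE [U `&` _]setIC [U `&` ~` _]setIC => PU.
rewrite -[X in _ = X - _](mulfV (lt0r_neq0 u0)) -mulrBl; congr (_ / _); lra.
Qed.

Lemma cond_survival01 U k : measurable U -> 0 < P U ->
  0 <= cond_prob mu U (tau_gt T U (k%:R : R)) <= 1.
Proof.
move=> mU u0; rewrite cond_probE.
have mt : measurable (tau_gt T U (k%:R : R)).
  rewrite tau_gt_nat; apply: (measurable_preimage (gm_measurableT GM)).
  exact: (measurable_avoid GM).
have mtU : measurable (tau_gt T U (k%:R : R) `&` U) by exact: measurableI.
apply/andP; split; first by rewrite divr_ge0// fine_probability_ge0.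
rewrite ler_pdivrMr// mul1r.
apply: countably_additive_le => //; first exact: countably_additive_probability.
exact: fine_probability_ge0.
Qed.

Lemma cond_survival_antitone U i j : measurable U -> 0 < P U -> (i <= j)%N ->
  cond_prob mu U (tau_gt T U (j%:R : R)) <= cond_prob mu U (tau_gt T U (i%:R : R)).
Proof.
move=> mU u0 ij; rewrite !cond_probE ler_wpM2r ?invr_ge0 ?(ltW u0)//.
have mt k : measurable (tau_gt T U (k%:R : R) `&` U).
  apply: measurableI => //; rewrite tau_gt_nat.
  apply: (measurable_preimage (gm_measurableT GM)).
  exact: (measurable_avoid GM).
apply: countably_additive_le => //; first exact: countably_additive_probability.
  exact: fine_probability_ge0.
by rewrite !tau_gt_nat => x [ax Ux]; split=> //; apply: avoid_le ax.
Qed.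

Lemma hit_prob_average U s : measurable U -> 0 < P U ->
  1 - P (avoid T U s) =
  P U * \sum_(i < s) cond_prob mu U (tau_gt T U (i%:R : R)).
Proof.
move=> mU u0; rewrite (hit_prob_sum GM s mU) mulr_sumr.
by apply: eq_bigr => i _; rewrite cond_probE mulrC divfK// gt_eqF.
Qed.

End LocalizedEscapeRate.

(** * Localized escape rate *)

(** Here u * (q * s) stands for the probability of a visit during a block of
    length s: q is the average of the conditional survival probabilities. *)
Lemma block_rate_ge (R : realType) (eps q s u k n : R) : 0 < eps <= 1 ->
  0 <= q <= 1 -> 0 < s -> 0 < u -> 0 <= k <= eps * s -> 0 <= n <= eps * s ->
  q - 3 * eps <= (1 - eps) * (u * (q * s)) / (k + (n + s)) / u.
Proof.
move=> /andP[e0 e1] /andP[q0 q1] s0 u0 /andP[k0 ks] /andP[n0 ns].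
have t0 : 0 < k + (n + s) by lra.
have -> : (1 - eps) * (u * (q * s)) / (k + (n + s)) / u =
    (1 - eps) * (q * s) / (k + (n + s)).
  by field; rewrite !gt_eqF.
rewrite ler_pdivlMr//.
have [h|h] := leP (q - 3 * eps) 0; last first.
  apply: (@le_trans _ _ ((q - 3 * eps) * ((1 + 2 * eps) * s))).
    by rewrite ler_wpM2l ?(ltW h)//; lra.
  rewrite mulrA [leRHS]mulrA ler_wpM2r ?(ltW s0)//; nra.
apply: (@le_trans _ _ 0); first exact: mulr_le0_ge0 h (ltW t0).
by rewrite !mulr_ge0 ?subr_ge0 ?(ltW s0).
Qed.

Lemma block_rate_le (R : realType) (eps q s u cn eta : R) : 0 < eps <= 1 ->
  0 <= q <= 1 -> 0 < s -> 0 < u -> 0 <= cn <= eps * s -> s * u <= eps / 36 ->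
  eta = cn * u + (1 + eps) * (u * (q * s)) ->
  eta <= 1 / 4 /\ eta / (1 - 3 * eta) / s / u <= q + 5 * eps.
Proof.
move=> /andP[e0 e1] /andP[q0 q1] s0 u0 /andP[c0 cs] su etaE.
have su0 : 0 < s * u by exact: mulr_gt0.
have eta_le : eta <= (q + 2 * eps) * (s * u).
  have h1 : cn * u <= eps * s * u by rewrite ler_wpM2r// ltW.
  have h2 : eps * q * (s * u) <= eps * 1 * (s * u).
    by rewrite ler_wpM2r ?(ltW su0)// ler_wpM2l// ltW.
  rewrite etaE; lra.
have eta12 : eta <= eps / 12.
  apply: (le_trans eta_le); apply: (@le_trans _ _ (3 * (s * u))); last by lra.
  by rewrite ler_wpM2r ?(ltW su0)//; lra.
split; first by lra.
have d0 : 0 < 1 - 3 * eta by lra.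
have -> : eta / (1 - 3 * eta) / s / u = eta / ((1 - 3 * eta) * (s * u)).
  by field; rewrite !gt_eqF.
rewrite ler_pdivrMr ?mulr_gt0//; apply: (le_trans eta_le).
rewrite [leRHS]mulrA ler_wpM2r ?(ltW su0)//.
have h : (q + 5 * eps) * (3 * eta) <= (q + 5 * eps) * (eps / 4).
  by rewrite ler_wpM2l//; lra.
have h2 : q * eps <= eps by rewrite ler_piMl// ltW.
have h3 : eps * eps <= eps by rewrite ler_piMl// ltW.
lra.
Qed.

Section LocalizedEscapeRateTheorem.
Context d {X : measurableType d} {R : realType}.
Variables (mu : probability X R) (T : X -> X) (A : set (set X)) (lambda : R).
Variable U : nat -> set X.
Local Notation P := (fprob mu).

Theorem localized_escape_rate : gibbs_markov mu T A lambda -> ergodic mu T ->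
  good_neighborhood_system mu T A U -> hat_alpha_exists mu T U ->
  exists alpha1 : R,
    [/\ \forall K \near \oo,
          cvgn (fun n => cond_prob mu (U n) (tau_gt T (U n) (K%:R : R))),
        limn (fun n => cond_prob mu (U n) (tau_gt T (U n) (K%:R : R)))
          @[K --> \oo] --> alpha1 &
        has_localized_escape_rate mu T U alpha1%:E].
Proof.
move=> GM ergT [[mU Upos _ U0] [kappa [_ uU _ [e e01 kcv]
  [C [p [C0 p1 appr]]]]]] [K0 hat].
pose u n := P (U n).
have uE n : mu (U n) = (u n)%:E by rewrite probability_fineK.
have u0 n : 0 < u n by rewrite -lte_fin -uE.
have ucv : u n @[n --> \oo] --> 0 by apply: fine_cvg; exact: U0.
pose x n k := cond_prob mu (U n) (tau_gt T (U n) (k%:R : R)).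
have xcv k : (K0 <= k)%N -> cvgn (fun n => x n k).
  move=> K0k; have h := hat k 2 K0k isT.
  rewrite (_ : (fun n => x n k) = fun n => 1 - hat_alpha_in mu T 2 k (U n)).
    by apply: is_cvgB => //; exact: is_cvg_cst.
  by apply/funext => n; rewrite (hat_alpha2E GM _ (mU n) (u0 n)) subKr.
pose alpha k := limn (fun n => x n k).
have x01 n k : 0 <= x n k <= 1 by exact: (cond_survival01 GM _ (mU n) (u0 n)).
have xanti n i j : (i <= j)%N -> x n j <= x n i.
  exact: (cond_survival_antitone GM (mU n) (u0 n)).
have [alpha1 acv] : exists l : R, alpha k @[k --> \oo] --> l.
  apply: (@nonincreasing_eventually_cvg _ alpha K0) => [k K0k|i j /andP[K0i ij]].
    apply: limr_ge; first exact: xcv.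
    by near=> n; case/andP: (x01 n k).
  apply: ler_lim; [exact: xcv (leq_trans K0i ij)|exact: xcv|].
  by near=> n; exact: xanti.
exists alpha1; split=> //; first by exists K0 => // k; exact: xcv.
have [c c1 [upper mixing]] := block_mixing GM ergT.
have dU n : determined T A (kappa n) (U n).
  exact: (determined_union_of (gm_trivIset GM) (uU n)).
split=> [n|].
  exact: (log_survival_rate_cvg GM (mU n) (dU n) c1 upper).
have [s sP] := block_length u0 ucv e01 kcv.
have avg := @average_survival_cvg R x alpha alpha1 c (C / (p - 1)) (p - 1) u s
  x01 xanti.
have {}avg : forall eps : R, 0 < eps -> \forall n \near \oo,
    alpha1 - eps <= (\sum_(i < s n) x n i) / (s n)%:R <= alpha1 + eps.
  apply: avg => //.
  - by exists K0 => // k K0k; exact: xcv.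
  - by rewrite (le_trans ler01).
  - by rewrite divr_ge0 ?subr_ge0 ?ltW.
  - by rewrite subr_gt0.
  - by move=> n; exact: ltW.
  - move=> n k m k0; rewrite /x !cond_probE -mulrBl -/(u n) ler_pdivrMr//.
    have := short_returns GM m (uU n) c1 upper C0 p1 (appr n) k0.
    move=> /le_trans; apply; rewrite opprB le_eqVlt; apply/orP; left; apply/eqP.
    by rewrite -/(u n); ring.
  - move=> delta d0; near=> n.
    have [? ? _] : [/\ (s n)%:R * u n <= delta, 1 <= delta * (s n)%:R &
        (kappa n)%:R <= delta * (s n)%:R] by near: n; exact: sP.
    by [].
have main (eps : R) : 0 < eps -> \forall n \near \oo, exists2 rho : R,
    escape_rate mu T (U n) = rho%:E &
    alpha1 - eps <= rho / u n <= alpha1 + eps.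
  move=> eps0; pose eps' := Num.min (eps / 6) 1.
  have e'0 : 0 < eps' by rewrite lt_min divr_gt0/=.
  have e'1 : eps' <= 1 by rewrite ge_min lexx orbT.
  have e'6 : 6 * eps' <= eps.
    by rewrite mulrC -ler_pdivlMr// ge_min lexx.
  have [N mix] := mixing eps' e'0.
  pose cN := (c + 1) * N%:R + 1.
  have c0 : 0 < c by apply: lt_le_trans c1.
  have cN0 : 0 < cN by rewrite ltr_wpDl// mulr_ge0// addr_ge0// ltW.
  pose delta := Num.min (eps' / 36) (eps' / cN).
  have d0 : 0 < delta by rewrite lt_min !divr_gt0.
  near=> n.
  have [su ss ks] : [/\ (s n)%:R * u n <= delta, 1 <= delta * (s n)%:R &
      (kappa n)%:R <= delta * (s n)%:R] by near: n; exact: sP.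
  have /andP[q1 q2] : alpha1 - eps' <= (\sum_(i < s n) x n i) / (s n)%:R <=
    alpha1 + eps' by near: n; exact: avg.
  have sn0 : 0 < (s n)%:R :> R.
    by rewrite -(pmulr_rgt0 _ d0) (lt_le_trans _ ss).
  have d1 : delta <= eps' / 36 by rewrite ge_min lexx.
  have d2 : delta * cN <= eps' by rewrite -ler_pdivlMr// ge_min lexx orbT.
  have d3 : delta * (s n)%:R * cN <= eps' * (s n)%:R.
    by rewrite mulrAC ler_wpM2r// ltW.
  have cNs : cN <= eps' * (s n)%:R.
    by apply: le_trans d3; rewrite ler_peMl// ltW.
  have Ns : N%:R <= eps' * (s n)%:R.
    apply: le_trans cNs; rewrite /cN mulrDl mul1r.
    by rewrite -addrA addrCA lerDl addr_ge0 ?mulr_ge0 ?(ltW c0).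
  have cNs' : c * N%:R <= eps' * (s n)%:R.
    apply: le_trans cNs; rewrite /cN mulrDl mul1r.
    by rewrite -addrA lerDl addr_ge0.
  have ks' : (kappa n)%:R <= eps' * (s n)%:R.
    by apply: (le_trans ks); rewrite ler_wpM2r ?(ltW sn0)//; clear -d1 e'0; lra.
  have e's : eps' * (s n)%:R <= (s n)%:R by rewrite ler_piMl// ltW.
  have kn : (kappa n <= s n)%N by rewrite -(ler_nat R) (le_trans ks').
  have Nn : (N <= s n)%N by rewrite -(ler_nat R) (le_trans Ns).
  have sn : (0 < s n)%N by rewrite -(ltr_nat R).
  set q := (_ / _) in q1 q2.
  have hit : 1 - P (avoid T (U n) (s n)) = u n * (q * (s n)%:R).
    by rewrite (hit_prob_average GM _ (mU n) (u0 n)) /q divfK// gt_eqF.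
  have q01 : 0 <= q <= 1.
    rewrite /q divr_ge0 ?sumr_ge0//=; last by move=> i _; case/andP: (x01 n i).
    rewrite ler_pdivrMr// mul1r.
    rewrite (_ : (s n)%:R = \sum_(i < s n) 1); last by rewrite sumr_const card_ord.
    by apply: ler_sum => i _; case/andP: (x01 n i).
  have t0 : (0 < kappa n + (N + s n))%N by rewrite !addn_gt0 sn !orbT.
  have lo := escape_rate_block_ge GM (mU n) (dU n) c1 upper mix t0.
  rewrite hit in lo.
  pose eta := c * N%:R * u n + (1 + eps') * (u n * (q * (s n)%:R)).
  have [eta4 hi'] : eta <= 1 / 4 /\
      eta / (1 - 3 * eta) / (s n)%:R / u n <= q + 5 * eps'.
    apply: (@block_rate_le R eps' q (s n)%:R (u n) (c * N%:R) eta) => //.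
    - by rewrite e'0.
    - by rewrite mulr_ge0//= ltW.
    - exact: le_trans su d1.
  have etaE : eta = c * N%:R * P (U n) + (1 + eps') * (1 - P (avoid T (U n) (s n))).
    by rewrite hit.
  have hi := escape_rate_block_le GM (mU n) (dU n) c1 upper mix (ltW e'0) etaE
    eta4 Nn kn sn.
  have lo' := @block_rate_ge R eps' q (s n)%:R (u n) (kappa n)%:R N%:R.
  have {}lo' : q - 3 * eps' <= (1 - eps') * (u n * (q * (s n)%:R)) /
      (kappa n + (N + s n))%:R / u n.
    by rewrite !natrD; apply: lo' => //; rewrite ?e'0 ?ler0n.
  move: lo hi; case: (escape_rate mu T (U n)) => [rho| |]//.
  rewrite !lee_fin => lo hi; exists rho => //.
  have un0 : 0 <= (u n)^-1 by rewrite invr_ge0 ltW.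
  have := ler_wpM2r un0 lo; have := ler_wpM2r un0 hi.
  move=> h1 h2; apply/andP; split.
    apply: le_trans (le_trans lo' h2).
    clear -q1 e'6 e'0; lra.
  apply: (le_trans (le_trans h1 hi')).
  clear -q2 e'6 e'0; lra.
apply: cvg_EFin.
  have := main 1 ltr01; apply: filterS => n [rho -> _].
  by rewrite uE inver gt_eqF.
apply/cvgrPdist_le => eps eps0; have := main eps eps0.
apply: filterS => n [rho rhoE /andP[h1 h2]] /=.
by rewrite rhoE uE inver gt_eqF//= ler_distl; apply/andP; split; lra.
Unshelve. all: by end_near. Qed.

End LocalizedEscapeRateTheorem.

Theorem theorem2 (R : realType) (M : pmetricType R)
    (mu : probability (borel M) R) (T : borel M -> borel M)
    (A : set (set (borel M))) (lambda : R) (U : nat -> set (borel M)) :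
  compact [set: M] ->
  gibbs_markov mu T A lambda ->
  ergodic mu T ->
  good_neighborhood_system mu T A U ->
  hat_alpha_exists mu T U ->
  (\sum_(1 <= l <oo) (l%:R * hat_alpha mu T U l)%:E < +oo)%E ->
  exists alpha1 : R,
    [/\ \forall K \near \oo,
          cvgn (fun n => cond_prob mu (U n) (tau_gt T (U n) (K%:R : R))),
        limn (fun n => cond_prob mu (U n) (tau_gt T (U n) (K%:R : R)))
          @[K --> \oo] --> alpha1 &
        has_localized_escape_rate mu T U alpha1%:E].
Proof.
move=> _ GM ergT goodU hatU _.
exact: (localized_escape_rate GM ergT goodU hatU).
Qed.
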